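(* Let $w=(w_1,\ldots,w_m)\in(0,1)^m$ be weights such that $w_1+\cdots+w_m=1$, and let $(A_1,\ldots,A_m)\in(\mathrm{UT}_n)^m$. Then the $w$-weighted Karcher mean $X=[x_{ij}]\in\mathrm{UT}_n$ of $(A_1,\ldots,A_m)$ is given by $X=DX'$, where $D=\mathrm{diag}(A_1^{w_1}\cdots A_m^{w_m})$ and $X'=[x'_{ij}]$ is a unipotent upper triangular matrix whose entries may be computed recursively as follows: $\mathrm{diag}(X')=I_n$, and for each $1\le p<q\le n$, $$x'_{pq}=\frac{1}{c_{pq}}\sum_{i=1}^m w_i\left(\sum_{\gamma\in\Gamma_{pq}}\log^{[\gamma]}\bigl(A_{(i)}\bigr)\,\Pi_\gamma\bigl((X'_{pq})^{-1}A_{(i)}\bigr)\right),$$ where $X'_{pq}$ is the unipotent upper triangular $n\times n$ matrix such that $(X'_{pq})_{ij}=x'_{ij}$ for $p\le i<j\le q$, $(i,j)\neq(p,q)$, and all its other strictly upper triangular entries are $0$.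
   Context: $\mathrm{UT}_n$ is the Lie group of $n\times n$ real upper triangular matrices with positive diagonal entries; $\log:\mathrm{UT}_n\to\mathfrak{ut}_n$ is the inverse of the matrix exponential $\exp:\mathfrak{ut}_n\to\mathrm{UT}_n$, where $\mathfrak{ut}_n$ is the space of real upper triangular $n\times n$ matrices, and $A^{w}=\exp(w\log A)$. The $w$-weighted Karcher mean of $(A_1,\ldots,A_m)$ is the (unique) solution $X\in\mathrm{UT}_n$ of $\sum_{i=1}^m w_i\log(X^{-1}A_i)=0$. ''Unipotent upper triangular'' means upper triangular with all diagonal entries equal to $1$. $\mathrm{diag}(A)$ is the diagonal matrix formed from the diagonal entries of $A$. Set $A_{(i)}:=D^{-1}A_i=[a^{(i)}_{pq}]$ for $i=1,\ldots,m$, and for $1\le p<q\le n$ $$c_{pq}:=\sum_{i=1}^m w_i\,a^{(i)}_{qq}\,\log^{[1]}\bigl(a^{(i)}_{pp},a^{(i)}_{qq}\bigr).$$ Divided differences: for an analytic function $f$, $f^{[0]}(a_1)=f(a_1)$ and for $k\ge1$, $f^{[k]}(a_1,\ldots,a_{k+1})=\frac{f^{[k-1]}(a_1,\ldots,a_k)-f^{[k-1]}(a_2,\ldots,a_{k+1})}{a_1-a_{k+1}}$ if $a_1\ne a_{k+1}$, and $f^{[k]}(a_1,\ldots,a_{k+1})=\frac{\partial f^{[k-1]}}{\partial x_1}(a_1,\ldots,a_k)$ if $a_1=a_{k+1}$. $\log^{[k]}$ is the $k$-th divided difference of the scalar logarithm. Paths: an $(i,j)$-path is a sequence of integers $\gamma=(i_1,\ldots,i_{k+1})$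 with $i=i_1<i_2<\cdots<i_{k+1}=j$; its length is $|\gamma|=k$. $\Gamma_{ij}$ is the set of all $(i,j)$-paths. For an upper triangular matrix $T=[t_{ij}]$ and such $\gamma$, $$\log^{[\gamma]}(T):=\log^{[k]}(t_{i_1i_1},\ldots,t_{i_{k+1}i_{k+1}}),\qquad \Pi_\gamma(T):=t_{i_1i_2}t_{i_2i_3}\cdots t_{i_ki_{k+1}}.$$ *)

(* Defs.v *)
From HB Require Import structures.
From mathcomp Require Import all_boot all_order all_algebra.
From mathcomp Require Import all_classical all_reals all_analysis.

Set Implicit Arguments.
Unset Strict Implicit.
Unset Printing Implicit Defensive.

Import Order.TTheory GRing.Theory Num.Theory.
Import numFieldTopology.Exports numFieldNormedType.Exports.

Local Open Scope classical_set_scope.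
Local Open Scope ring_scope.

Section TriangularMatrices.
Context {R : realType} {n : nat}.
Implicit Types (A B X T : 'M[R]_n) (i j p q : 'I_n).

(* [is_trig_mx] means lower triangular in MathComp, whence the transpose. *)
Definition upper_triangular A : bool := is_trig_mx A^T.

Definition ut : set 'M[R]_n := [set A | upper_triangular A].

Definition UT : set 'M[R]_n :=
  [set A | upper_triangular A /\ forall i, 0 < A i i].

Definition unipotent A : Prop := upper_triangular A /\ forall i, A i i = 1.

Definition diag_part A : 'M[R]_n := diag_mx (\row_i A i i).

Definition expm A : 'M[R]_n :=
  limn (series (fun k => (k`!%:R)^-1 *: A ^+ k)).

(* The inverse of [expm : ut -> UT]; the default value 0 is only taken when
   A has no preimage in [ut]. *)
Definition logm A : 'M[R]_n := xget 0 [set B | ut B /\ expm B = A].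

Definition powm A (t : R) : 'M[R]_n := expm (t *: logm A).

(* An increasing sequence in 'I_n has at most n entries, so the bound on the
   size is harmless. *)
Definition paths i j : {set n.-bseq 'I_n} :=
  [set g : n.-bseq 'I_n |
    [&& sorted (fun a b : 'I_n => (a < b)%N) g,
        ohead g == Some i & last i g == j]]%SET.

Definition path_length (g : seq 'I_n) : nat := (size g).-1.

End TriangularMatrices.

Section DividedDifferences.
Context {R : realType}.

(* [divdiff f k [:: a_1; ...; a_(k+1)]] is f^[k](a_1, ..., a_(k+1)); it is only
   meaningful when the list has k + 1 entries. *)
Fixpoint divdiff (f : R -> R) (k : nat) (a : seq R) : R :=
  let a1 := head 0 a in
  let alast := last 0 a in
  if k is k'.+1 then
    if a1 == alast then derive1 (fun x => divdiff f k' (x :: behead (take k a))) a1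
    else (divdiff f k' (take k a) - divdiff f k' (behead a)) / (a1 - alast)
  else f a1.

Definition log_path {n : nat} (T : 'M[R]_n) (g : seq 'I_n) : R :=
  divdiff (@ln R) (path_length g) [seq T i i | i <- g].

Definition prod_path {n : nat} (T : 'M[R]_n) (g : seq 'I_n) : R :=
  \prod_(e <- zip g (behead g)) T e.1 e.2.

End DividedDifferences.

Section KarcherMean.
Context {R : realType} {m n : nat}.
Variables (w : 'I_m -> R) (A : 'I_m -> 'M[R]_n).

Definition karcher_equation (X : 'M[R]_n) : Prop :=
  UT X /\ \sum_(i < m) w i *: logm (invmx X *m A i) = 0.

Definition is_karcher_mean : 'M[R]_n -> Prop := unique karcher_equation.

Definition karcher_diag : 'M[R]_n :=
  diag_part (\prod_(i < m) powm (A i) (w i)).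

Definition normalized (i : 'I_m) : 'M[R]_n := invmx karcher_diag *m A i.

Definition karcher_coef (p q : 'I_n) : R :=
  \sum_(i < m) w i * normalized i q q *
    divdiff (@ln R) 1 [:: normalized i p p; normalized i q q].

Definition truncated_block (X' : 'M[R]_n) (p q : 'I_n) : 'M[R]_n :=
  \matrix_(i, j)
    if i == j then 1
    else if [&& (p <= i)%N, (i < j)%N, (j <= q)%N & (i, j) != (p, q)]
      then X' i j
    else 0.

Definition karcher_recursion (X' : 'M[R]_n) : Prop :=
  unipotent X' /\
  forall p q : 'I_n, (p < q)%N ->
    X' p q = 1 / karcher_coef p q *
      \sum_(i < m) w i *
        (\sum_(g in paths p q)
           log_path (normalized i) g *
           prod_path (invmx (truncated_block X' p q) *m normalized i) g).

End KarcherMean.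

(* Main.v *)
Require Import Defs.
From HB Require Import structures.
From mathcomp Require Import all_boot all_order all_algebra.
From mathcomp Require Import all_classical all_reals all_analysis.
From mathcomp Require Import ring lra.

Set Implicit Arguments.
Unset Strict Implicit.
Unset Printing Implicit Defensive.

Import Order.TTheory GRing.Theory Num.Theory.
Import numFieldTopology.Exports numFieldNormedType.Exports.

Local Open Scope classical_set_scope.
Local Open Scope ring_scope.

(**
   For a bounded sequence c and [`|x| < 1], write f x = sum_j c_j x^j and let
   S be the shift on sequences.  The resolvent E_x = (1 - x S)^-1 acts on
   bounded sequences, f x = (E_x c)_0, and the resolvent identity
   E_x - E_y = (x - y) S E_x E_y shows that the divided differences of f are
   f^[k](x_1, ..., x_(k+1)) = (E_(x_1) ... E_(x_(k+1)) c)_k; commutation of the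
   resolvents gives their symmetry, and continuity of x |-> E_x the confluent
   case.  Summing these along paths yields a matrix f(T) which is
   characterized by a matrix recursion with a unique bounded solution, hence
   commutes with everything that commutes with T.

   exp (rescaled) and log (expanded around a large M, as
   log x = log M - sum_j (1 - x/M)^j / j) are both of this form.  For
   triangular T with distinct diagonal entries, exp (log T) is triangular,
   commutes with T and has the diagonal of T, so it is T; perturbing the
   diagonal and passing to the limit covers every T, and log (exp T) = T
   likewise.  So the matrix logarithm is given by the path formula.

   In the Karcher equation the diagonal entries force diag X = D, and in the
   (p, q) entry the unknown x'_pq occurs only through the path (p, q), with
   coefficient - c_pq < 0; all other terms involve entries strictly closer to
   the diagonal.
*)

(** * Resolvents of the shift on bounded sequences *)

Section Resolvent.
Context {R : realType}.
Implicit Types (x y C : R) (c d : R^nat).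

Definition bdd c : Prop := exists C, forall j, `|c j| <= C.

Definition seqshift (k : nat) c : R^nat := fun j => c (k + j)%N.

(* (1 - x S)^-1 c, where S is the shift [seqshift 1]. *)
Definition resolvent x c : R^nat :=
  fun j => limn (series (fun i => c (j + i)%N * x ^+ i)).

Lemma bdd_shift k c : bdd c -> bdd (seqshift k c).
Proof. by case=> C cC; exists C => j; apply: cC. Qed.

Lemma bddD c d : bdd c -> bdd d -> bdd (fun j => c j + d j).
Proof.
move=> [C cC] [D dD]; exists (C + D) => j.
by rewrite (le_trans (ler_normD _ _))// lerD.
Qed.

Lemma bddZ a c : bdd c -> bdd (fun j => a * c j).
Proof. by move=> [C cC]; exists (`|a| * C) => j; rewrite normrM ler_wpM2l. Qed.

Lemma bddB c d : bdd c -> bdd d -> bdd (fun j => c j - d j).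
Proof.
move=> bc bd; have := bddD bc (bddZ (-1) bd).
by congr bdd; apply/funext => j; rewrite mulN1r.
Qed.

Lemma bdd_sum (I : finType) (P : pred I) (c : I -> R^nat) :
  (forall i, bdd (c i)) -> bdd (fun j => \sum_(i | P i) c i j).
Proof.
move=> bc; pose D i := sval (cid (bc i)); exists (\sum_(i | P i) D i) => j.
by rewrite (le_trans (ler_norm_sum _ _ _))// ler_sum// => i _; rewrite /D; case: cid.
Qed.

Section Fixed.
Variables (x : R) (x1 : `|x| < 1).

Let cvg_bound C : series (geometric C `|x|) @ \oo --> C / (1 - `|x|).
Proof. by apply: cvg_geometric_series; rewrite normr_id. Qed.

Let cvg_abs C c j : (forall i, `|c i| <= C) ->
  cvgn [normed series (fun i => c (j + i)%N * x ^+ i)].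
Proof.
move=> cC; apply: (@series_le_cvg _ _ (geometric C `|x|)) => [i|i|i|].
- by rewrite normr_ge0.
- by rewrite geometric_ge0// (le_trans _ (cC 0)).
- by rewrite /= normrM normrX ler_wpM2r.
- by have := @cvg_bound C => /cvgP; apply.
Qed.

Lemma is_cvg_resolvent c j : bdd c ->
  cvgn (series (fun i => c (j + i)%N * x ^+ i)).
Proof. by case=> C cC; apply/normed_cvg/cvg_abs. Qed.

Lemma resolvent_bound C c j : (forall i, `|c i| <= C) ->
  `|resolvent x c j| <= C / (1 - `|x|).
Proof.
move=> cC; rewrite -(cvg_lim _ (@cvg_bound C))//.
apply: (le_trans (@lim_series_norm R R^o _ (cvg_abs (j := j) cC))).
apply: lim_series_le; first exact: cvg_abs.
  by have := @cvg_bound C => /cvgP; apply.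
by move=> i; rewrite /= normrM normrX ler_wpM2r.
Qed.

Lemma bdd_resolvent c : bdd c -> bdd (resolvent x c).
Proof. by case=> C cC; exists (C / (1 - `|x|)) => j; apply: resolvent_bound. Qed.

Lemma resolventE c j : bdd c -> resolvent x c j = c j + x * resolvent x c j.+1.
Proof.
move=> bc; have cS := @is_cvg_resolvent c j.+1 bc.
apply/cvg_lim => //; rewrite -(cvg_shiftS _) mulrC.
pose u k := c j + series (fun i => c (j.+1 + i)%N * x ^+ i) k * x.
rewrite (_ : [sequence _]_n = u).
  by apply: cvgD; [exact: cvg_cst|exact: cvgMr_tmp cS].
apply/funext => k.
rewrite /u /series /= big_nat_recl// addn0 expr0 mulr1 mulr_suml.
congr (_ + _); apply: eq_bigr => i _.
by rewrite exprSr mulrA addnS addSn.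
Qed.

(** Iteration gives d_j = x^k d_(j+k), which tends to 0 as k grows because d is bounded. *)
Lemma resolvent_inj0 d : bdd d -> (forall j, d j = x * d j.+1) -> forall j, d j = 0.
Proof.
move=> [C dC] dE j.
have dX k : d j = x ^+ k * d (j + k)%N.
  elim: k => [|k ->]; first by rewrite addn0 mul1r.
  by rewrite dE exprSr mulrA addnS.
apply/eqP; rewrite -normr_le0.
have cX : (fun k => C * `|x| ^+ k) @ \oo --> (0 : R).
  by have := @cvg_geometric R C `|x|; apply; rewrite normr_id.
rewrite -(cvg_lim _ cX)//; apply: limr_ge; first exact: cvgP cX.
by apply: nearW => k; rewrite [X in `|X|](dX k) normrM normrX mulrC ler_wpM2r.
Qed.

(** Later identities between resolvents are proved by checking this recursion and boundedness,
    without manipulating series. *)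
Lemma resolvent_uniq c d : bdd c -> bdd d ->
  (forall j, d j = c j + x * d j.+1) -> d = resolvent x c.
Proof.
move=> bc bd dE; apply/funext => j; apply/eqP; rewrite -subr_eq0; apply/eqP.
apply: (resolvent_inj0 (bddB bd (bdd_resolvent bc))) => {}j.
by rewrite dE resolventE// mulrBr; ring.
Qed.

Lemma resolvent_shift k c : bdd c ->
  resolvent x (seqshift k c) = seqshift k (resolvent x c).
Proof.
move=> bc; apply/esym/resolvent_uniq; first exact: bdd_shift.
  exact/bdd_shift/bdd_resolvent.
by move=> j; rewrite /seqshift resolventE// addnS.
Qed.

Lemma resolventB c d : bdd c -> bdd d ->
  resolvent x (fun j => c j - d j) = fun j => resolvent x c j - resolvent x d j.
Proof.
move=> bc bd; apply/esym/resolvent_uniq; first exact: bddB.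
  by apply: bddB; exact: bdd_resolvent.
by move=> j; rewrite !(@resolventE _ j)//; ring.
Qed.

Lemma resolventZ a c : bdd c ->
  resolvent x (fun j => a * c j) = fun j => a * resolvent x c j.
Proof.
move=> bc; apply/esym/resolvent_uniq; first exact: bddZ.
  by apply: bddZ; exact: bdd_resolvent.
by move=> j; rewrite !(@resolventE _ j)//; ring.
Qed.

End Fixed.

(** With u = E_x E_y c, the sequence u - y S u satisfies the recursion characterizing E_x c. So u =
    E_x c + y S u, which characterizes E_y E_x c. *)
Lemma resolventC x y c : `|x| < 1 -> `|y| < 1 -> bdd c ->
  resolvent x (resolvent y c) = resolvent y (resolvent x c).
Proof.
move=> x1 y1 bc.
have [bx by_] := (bdd_resolvent x1 bc, bdd_resolvent y1 bc).
have bxy := bdd_resolvent x1 by_.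
apply: resolvent_uniq => //.
have -> : resolvent x c =
    fun j => resolvent x (resolvent y c) j - y * resolvent x (resolvent y c) j.+1.
  apply/esym/resolvent_uniq => //.
    by apply: bddB => //; apply: bddZ; apply: (bdd_shift 1).
  move=> j; rewrite [in LHS]resolventE// [in X in _ - y * X]resolventE//.
  by rewrite [resolvent y c j]resolventE//; ring.
by move=> j; rewrite subrK.
Qed.

(** The resolvent identity: E_y c + (x - y) S E_x E_y c satisfies the recursion of E_x c. *)
Lemma resolvent_sub x y c j : `|x| < 1 -> `|y| < 1 -> bdd c ->
  resolvent x c j - resolvent y c j =
  (x - y) * resolvent x (resolvent y c) j.+1.
Proof.
move=> x1 y1 bc.
have [bx by_] := (bdd_resolvent x1 bc, bdd_resolvent y1 bc).
have bxy := bdd_resolvent x1 by_.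
have -> : resolvent x c = fun j =>
    resolvent y c j + (x - y) * resolvent x (resolvent y c) j.+1.
  apply/esym/resolvent_uniq => //.
    by apply: bddD => //; apply: bddZ; apply: (bdd_shift 1).
  move=> i; rewrite (@resolventE _ x1 _ i.+1)// (@resolventE _ y1 c i)//.
  by ring.
by ring.
Qed.

Section Continuity.
Context {I : Type} (F : set_system I) {FF : Filter F}.

(* Uniform convergence along F, witnessed by an explicit rate. *)
Definition ucvg (cs : I -> R^nat) c : Prop :=
  exists2 e : I -> R, e i @[i --> F] --> 0 &
    \forall i \near F, forall j, `|cs i j - c j| <= e i.

Lemma ucvg_cst c : ucvg (fun=> c) c.
Proof.
exists (fun=> 0); first exact: cvg_cst.
by apply: nearW => i j; rewrite subrr normr0.
Qed.

Lemma ucvg_cvg cs c j : ucvg cs c -> cs i j @[i --> F] --> c j.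
Proof.
move=> [e e0 ce]; apply/cvgrPdist_le => eps eps0.
move/cvgr0_norm_le: e0 => /(_ _ eps0) e0.
near=> i; rewrite distrC; apply: (@le_trans _ _ (e i)).
  by near: i; apply: filterS ce => i; apply.
by apply: (le_trans (ler_norm _)); near: i.
Unshelve. all: by end_near. Qed.

(** The error splits as E_(x_i) (c_i - c) + (x_i - x) S E_(x_i) E_x c. Each resolvent costs at most
    a factor 1 / (1 - |x_i|), which converges; this yields the explicit rate. *)
Lemma ucvg_resolvent (xs : I -> R) x (cs : I -> R^nat) c :
  `|x| < 1 -> xs i @[i --> F] --> x -> (\forall i \near F, bdd (cs i)) -> bdd c ->
  ucvg cs c -> ucvg (fun i => resolvent (xs i) (cs i)) (resolvent x c).
Proof.
move=> x1 xsx bcs bc [e e0 ce].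
have [C cC] := bdd_resolvent x1 bc.
pose u i := (1 - `|xs i|)^-1.
have ucv : u i @[i --> F] --> (1 - `|x|)^-1.
  apply: cvgV; first by rewrite gt_eqF// subr_gt0.
  by apply: cvgB; [exact: cvg_cst|exact: cvg_norm].
have xs1 : \forall i \near F, `|xs i| < 1.
  by have := cvgr_lt _ (cvg_norm xsx); apply.
exists (fun i => e i * u i + `|xs i - x| * (C * u i)).
  rewrite -[0](addr0 0); apply: cvgD.
    by rewrite -[X in _ --> X](mul0r (1 - `|x|)^-1); apply: cvgM.
  rewrite -[X in _ --> X](mul0r (C * (1 - `|x|)^-1)); apply: cvgM.
    rewrite -(@normr0 _ R^o) -(subrr x); apply: cvg_norm; apply: cvgB => //; exact: cvg_cst.
  by apply: cvgM => //; apply: cvg_cst.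
near=> i => j.
have x'1 : `|xs i| < 1 by near: i.
have bci : bdd (cs i) by near: i.
have -> : resolvent (xs i) (cs i) j - resolvent x c j =
    resolvent (xs i) (fun k => cs i k - c k) j +
    (xs i - x) * resolvent (xs i) (resolvent x c) j.+1.
  by rewrite resolventB// -resolvent_sub//; ring.
rewrite (le_trans (ler_normD _ _))// lerD//.
  apply: resolvent_bound => // k; move: k; near: i; exact: ce.
by rewrite normrM ler_wpM2l//; exact: resolvent_bound.
Unshelve. all: by end_near. Qed.

End Continuity.

End Resolvent.

(** * Sums over increasing paths *)

Section PathSums.
Context {n : nat} {V : nmodType}.
Implicit Types (i j k : 'I_n) (G : seq 'I_n -> V).

Let lt_trans : transitive (fun a b : 'I_n => (a < b)%N).
Proof. by move=> a b c; apply: ltn_trans. Qed.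

Lemma path_le i (g : seq 'I_n) :
  path (fun a b : 'I_n => (a < b)%N) i g -> (i <= last i g)%N.
Proof.
elim: g i => //= k g IH i /andP[ik /IH]; exact/leq_trans/ltnW.
Qed.

(** Replaces bounded sequences by plain lists: a strictly increasing sequence has no repetition,
    hence at most n entries. *)
Lemma big_paths i j G (s : seq (seq 'I_n)) : uniq s ->
  (forall g, (g \in s) = [&& sorted (fun a b : 'I_n => (a < b)%N) g,
                             ohead g == Some i & last i g == j]) ->
  \sum_(g in paths i j) G g = \sum_(g <- s) G g.
Proof.
move=> us sP; rewrite -big_enum /= -(big_map val xpredT G).
apply: perm_big; apply: uniq_perm => //.
  by rewrite map_inj_uniq ?enum_uniq//; exact: val_inj.
move=> g; rewrite sP; apply/mapP/idP.
  by move=> [b]; rewrite mem_enum inE => ? ->.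
move=> gP; have gn : (size g <= n)%N.
  have ug : uniq g.
    by case/andP: gP => + _; apply: sorted_uniq => // a; exact: ltnn.
  by rewrite -(card_uniqP ug) (leq_trans (max_card _))// card_ord.
by exists (Bseq gn) => //; rewrite mem_enum inE.
Qed.

Lemma big_paths0 i j G : (j < i)%N -> \sum_(g in paths i j) G g = 0.
Proof.
move=> ji; rewrite (@big_paths i j G [::]) ?big_nil// => -[|k g].
  by rewrite andbF.
rewrite in_nil; apply/esym/negP => /and3P[/= /path_le kg /eqP[ki] /eqP gj].
by move: ji; rewrite ltnNge -gj -ki kg.
Qed.

Lemma big_paths_refl i G : \sum_(g in paths i i) G g = G [:: i].
Proof.
rewrite (@big_paths i i G [:: [:: i]]) ?big_seq1// => -[|k [|l g]].
- by rewrite inE.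
- by rewrite inE /= andbC; case: (k =P i) => [->|ki]; rewrite ?eqxx//; apply/eqP => -[].
- rewrite inE eqseq_cons /= andbF; apply/esym/negP.
  move=> /and3P[/andP[kl /path_le lg] /eqP[ki] /eqP gi].
  by move: lg; rewrite leqNgt gi -ki kl.
Qed.

(** Splits off the first step of a path. Vertices k beyond j may be kept, since no path leads from
    them to j. *)
Lemma big_paths_step i j G : (i < j)%N ->
  \sum_(g in paths i j) G g =
  \sum_(k : 'I_n | (i < k)%N) \sum_(g in paths k j) G (i :: g).
Proof.
move=> ij.
pose s := [seq i :: g | k <- enum [pred k : 'I_n | (i < k)%N],
                        g <- map val (enum (paths k j))].
rewrite (@big_paths i j G s).
- rewrite big_allpairs_dep /= big_enum_cond /=; apply: eq_big => k; rewrite ?inE ?andbT// => _.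
  by rewrite big_map big_enum.
- apply: allpairs_uniq_dep; first exact: enum_uniq.
    by move=> k _; rewrite map_inj_uniq ?enum_uniq//; exact: val_inj.
  move=> x y /allpairsPdep[k [g [_ /mapP[b bP gb] ->]]].
  move=> /allpairsPdep[k' [g' [_ /mapP[b' b'P gb'] ->]]] /= [gg'].
  subst g' g; move/val_inj: gg' b'P => <-; rewrite !mem_enum !inE in bP *.
  by case/and3P: bP => _ /eqP bk _ /and3P[_ /eqP]; rewrite bk => -[->].
move=> g; apply/allpairsPdep/and3P.
  move=> [k [_ [+ /mapP[g' + ->] ->]]]; rewrite !mem_enum !inE => ik.
  case: g' => -[|l g'] //= _ /and3P[lg /eqP[lk] gj].
  by rewrite lk ik -lk lg eqxx.
case: g => [|l [|k g]] [] //=; first by move=> _ /eqP[->]; rewrite -val_eqE ltn_eqF.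
move=> /andP[lk kg] /eqP[li] gj; rewrite {l}li in lk *.
exists k, (k :: g); rewrite mem_enum inE; split => //.
have gn : (size (k :: g) <= n)%N.
  have ug : uniq (k :: g) by apply: (sorted_uniq lt_trans) => // a; exact: ltnn.
  by rewrite -(card_uniqP ug) (leq_trans (max_card _))// card_ord.
by apply/mapP; exists (Bseq gn) => //; rewrite mem_enum inE /= kg eqxx.
Qed.

End PathSums.

(** * Products of upper triangular matrices and of entries along paths *)

Section UpperTriangular.
Context {R : realType} {n : nat}.
Implicit Types (A B S T X Y Z : 'M[R]_n) (i j k p q : 'I_n).

Lemma upper_triangularP A :
  reflect (forall i j, (j < i)%N -> A i j = 0) (upper_triangular A).
Proof.
rewrite /upper_triangular; apply: (iffP is_trig_mxP) => At i j ij; first by have := At j i ij; rewrite mxE.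
by rewrite mxE At.
Qed.

Lemma upper_triangular_mulE A B i j :
  upper_triangular A -> upper_triangular B ->
  (A *m B) i j = \sum_(k : 'I_n | (i <= k <= j)%N) A i k * B k j.
Proof.
move=> /upper_triangularP At /upper_triangularP Bt.
rewrite mxE (bigID (fun k : 'I_n => (i <= k <= j)%N)) /= [X in _ + X]big1 ?addr0//.
move=> k; rewrite negb_and -!ltnNge => /orP[ki|jk]; first by rewrite At ?mul0r.
by rewrite Bt ?mulr0.
Qed.

Lemma upper_triangular_mul A B :
  upper_triangular A -> upper_triangular B -> upper_triangular (A *m B).
Proof.
move=> At Bt; apply/upper_triangularP => i j ji.
rewrite upper_triangular_mulE// big1// => k /andP[ik kj].
by move: ji; rewrite ltnNge (leq_trans ik kj).
Qed.

Lemma upper_triangular_mul_diag A B i :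
  upper_triangular A -> upper_triangular B -> (A *m B) i i = A i i * B i i.
Proof.
move=> At Bt; rewrite upper_triangular_mulE//.
by rewrite (big_pred1 i)// => k; rewrite -eqn_leq eq_sym.
Qed.

Lemma prod_path_cons S i k (g : seq 'I_n) :
  ohead g = Some k -> prod_path S (i :: g) = S i k * prod_path S g.
Proof. by case: g => //= _ g [->]; rewrite /prod_path /= big_cons. Qed.

Lemma prod_path1 S i : prod_path S [:: i] = 1.
Proof. by rewrite /prod_path big_nil. Qed.

End UpperTriangular.

(** * The path formula for a power series in a triangular matrix *)

Section MatrixCalculus.
Context {R : realType} {n : nat}.
Implicit Types (A B S T X Y Z : 'M[R]_n) (i j k p q : 'I_n) (c : R^nat).

Definition sub_unit_diag S : Prop :=
  upper_triangular S /\ forall i, `|S i i| < 1.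

(** For m = 0 and a path of length k, the resolvent factor is the divided difference f^[k] at the
    diagonal entries along the path. *)
Definition path_term c S (m : nat) (g : seq 'I_n) : R :=
  foldr resolvent c [seq S i i | i <- g] (path_length g + m)%N * prod_path S g.

(* The path formula for sum_j c_(m+j) S^j; the index m is carried along so that
   [mxcalc_rec] is a recursion, and f(S) is the value at m = 0. *)
Definition mxcalc c S (m : nat) : 'M[R]_n :=
  \matrix_(p, q) \sum_(g in paths p q) path_term c S m g.

Lemma bdd_foldr_resolvent c (s : seq R) :
  bdd c -> {in s, forall x, `|x| < 1} -> bdd (foldr resolvent c s).
Proof.
move=> bc; elim: s => //= x s IH s1; apply: bdd_resolvent.
  by apply: s1; rewrite mem_head.
by apply: IH => y ys; apply: s1; rewrite in_cons ys orbT.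
Qed.

Lemma bdd_foldr_diag c S (g : seq 'I_n) : bdd c -> sub_unit_diag S ->
  bdd (foldr resolvent c [seq S i i | i <- g]).
Proof.
by move=> bc [_ S1]; apply: bdd_foldr_resolvent => // _ /mapP[i _ ->].
Qed.

Lemma bdd_mxcalc c S p q : bdd c -> sub_unit_diag S ->
  bdd (fun m => mxcalc c S m p q).
Proof.
move=> bc Su; under eq_fun do rewrite mxE.
apply: bdd_sum => g; rewrite /path_term; under eq_fun do rewrite mulrC.
exact/bddZ/bdd_shift/bdd_foldr_diag.
Qed.

Lemma upper_triangular_mxcalc c S m : upper_triangular (mxcalc c S m).
Proof. by apply/upper_triangularP => p q qp; rewrite mxE big_paths0. Qed.

Lemma mxcalc_diag c S m p : mxcalc c S m p p = resolvent (S p p) c m.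
Proof. by rewrite mxE big_paths_refl /path_term prod_path1 mulr1. Qed.

(** In each path, [resolventE] is applied at the first vertex p. Its constant term gives the summand
    S_pk with the shortened path from k, and its other term gives the summand S_pp with the whole
    path. *)
Lemma mxcalc_rec c S m : bdd c -> sub_unit_diag S ->
  mxcalc c S m = (c m)%:M + S *m mxcalc c S m.+1.
Proof.
move=> bc Su; have [St S1] := Su; apply/matrixP => p q; rewrite [RHS]mxE [X in _ = X + _]mxE.
have Ft := upper_triangular_mxcalc c S m.+1.
have [qp|pq|] := ltngtP q p; last first.
- move=> /val_inj ->; rewrite eqxx mulr1n upper_triangular_mul_diag//.
  by rewrite !mxcalc_diag -resolventE.
- rewrite eqE /= ltn_eqF// add0r upper_triangular_mulE//.
  rewrite (bigD1 p) /=; last by rewrite leqnn ltnW.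
  have -> : \sum_(k < n | (p <= k <= q)%N && (k != p))
      S p k * mxcalc c S m.+1 k q =
    \sum_(k < n | (p < k)%N) S p k * mxcalc c S m.+1 k q.
    rewrite [RHS](bigID (fun k : 'I_n => (k <= q)%N)) /= [X in _ + X]big1 ?addr0.
      apply: eq_bigl => k; rewrite -[k != p]/(k != p :> nat) [(p < k)%N]ltn_neqAle.
      by rewrite eq_sym; case: (_ == _); case: (_ <= _)%N => //=; rewrite andbC.
    move=> k /andP[_]; rewrite -ltnNge => qk.
    by rewrite (upper_triangularP _ Ft)// mulr0.
  rewrite !mxE !big_paths_step// mulr_sumr -big_split; apply: eq_bigr => k pk /=.
  rewrite mxE !mulr_sumr -big_split /=; apply: eq_bigr => g.
  rewrite inE => /and3P[_ /eqP gk _].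
  rewrite /path_term (prod_path_cons _ _ gk) /path_length.
  case: (bseqval g) gk => //= l g' [->] /=.
  rewrite resolventE//; last exact: (bdd_foldr_diag (k :: g')).
  by rewrite !addSn !addnS; ring.
- rewrite (upper_triangularP _ (upper_triangular_mul St Ft))// addr0.
  rewrite (upper_triangularP _ (upper_triangular_mxcalc c S m))//.
  by rewrite eqE /= gtn_eqF.
Qed.

(** Rows are treated from the last to the first: once the rows below p vanish, row p obeys the
    scalar recursion of [resolvent_inj0] with x = S_pp. *)
Lemma mx_rec_inj0 S (X : nat -> 'M[R]_n) : sub_unit_diag S ->
  (forall p q, bdd (fun m => X m p q)) -> (forall m, X m = S *m X m.+1) ->
  forall m, X m = 0.
Proof.
move=> [/upper_triangularP St S1] bX XE m; apply/matrixP => p q; rewrite [RHS]mxE.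
have [d] := ubnP (n - p); elim: d => // d IH in m p *; rewrite ltnS => pd.
apply: (resolvent_inj0 (S1 p) (bX p q)) => {}m.
rewrite {1}XE mxE (bigD1 p)//= big1 ?addr0// => k kp.
have [ltkp|lepk] := ltnP k p; first by rewrite St// mul0r.
rewrite IH ?mulr0//; apply: leq_trans pd; apply: ltn_sub2l => //.
by rewrite ltn_neqAle lepk eq_sym kp.
Qed.

Lemma bdd_mulmx A (X : nat -> 'M[R]_n) p q :
  (forall p q, bdd (fun m => X m p q)) -> bdd (fun m => (A *m X m) p q).
Proof.
move=> bX; under eq_fun do rewrite mxE.
by apply: bdd_sum => k; exact: bddZ.
Qed.

Lemma bdd_mulmxr A (X : nat -> 'M[R]_n) p q :
  (forall p q, bdd (fun m => X m p q)) -> bdd (fun m => (X m *m A) p q).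
Proof.
move=> bX; under eq_fun do rewrite mxE.
by apply: bdd_sum => k; under eq_fun do rewrite mulrC; exact: bddZ.
Qed.

(** The commutator is bounded and satisfies the homogeneous recursion, because scalar matrices
    cancel and Z commutes with S. *)
Lemma mxcalc_comm c S Z m : bdd c -> sub_unit_diag S ->
  Z *m S = S *m Z -> Z *m mxcalc c S m = mxcalc c S m *m Z.
Proof.
move=> bc Su ZS; apply/eqP; rewrite -subr_eq0; apply/eqP.
pose X m := Z *m mxcalc c S m - mxcalc c S m *m Z.
apply: (@mx_rec_inj0 S X) => // [p q|{}m].
  rewrite (_ : (fun _ => _) = fun m =>
      (Z *m mxcalc c S m) p q - (mxcalc c S m *m Z) p q); last first.
    by apply/funext => {}m; rewrite /X mxE [X in _ + X]mxE.
  apply: bddB; [apply: bdd_mulmx|apply: bdd_mulmxr] => ? ?; exact: bdd_mxcalc.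
rewrite /X (mxcalc_rec m)// !mulmxDr !mulmxDl mulmxN !mulmxA ZS.
by rewrite scalar_mxC opprD addrACA subrr add0r.
Qed.

(** The recursion unfolded N times: a partial sum of the power series with an exact remainder. *)
Lemma mxcalc_sum c S N : bdd c -> sub_unit_diag S ->
  mxcalc c S 0 = \sum_(k < N) c k *: S ^+ k + S ^+ N *m mxcalc c S N.
Proof.
move=> bc Su; elim: N => [|N ->]; first by rewrite big_ord0 add0r mul1mx.
rewrite big_ord_recr /= -addrA; congr (_ + _).
rewrite {1}mxcalc_rec// mulmxDr mul_mx_scalar; congr (_ + _).
by rewrite mulmxA exprSr.
Qed.

(** Each resolvent along a path costs a factor 1 / (1 - |S_ii|), so K depends on S alone. Uniformity
    in c is what makes small tails give small remainders. *)
Lemma mxcalc_bound S : sub_unit_diag S -> exists2 K : R, 0 <= K &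
  forall c (C : R), (forall t, `|c t| <= C) ->
    forall m p q, `|mxcalc c S m p q| <= K * C.
Proof.
move=> [St S1].
pose P (g : seq 'I_n) := \prod_(i <- g) (1 - `|S i i|)^-1.
have P0 g : 0 <= P g by apply: prodr_ge0 => i _; rewrite invr_ge0 subr_ge0 ltW.
have fP c C (g : seq 'I_n) : (forall t, `|c t| <= C) ->
    forall m, `|foldr resolvent c [seq S i i | i <- g] m| <= C * P g.
  move=> cC; elim: g => [|i g IH] m /=; first by rewrite /P big_nil mulr1 cC.
  rewrite /P big_cons -/(P g) mulrA mulrAC.
  exact: (resolvent_bound (S1 i)).
pose K p q := \sum_(g in paths p q) P g * `|prod_path S g|.
have K0 p q : 0 <= K p q by apply: sumr_ge0 => g _; rewrite mulr_ge0.
exists (\sum_p \sum_q K p q).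
  by apply: sumr_ge0 => p _; apply: sumr_ge0 => q _.
move=> c C cC m p q; have C0 : 0 <= C := le_trans (normr_ge0 _) (cC 0%N).
apply: (@le_trans _ _ (K p q * C)); last first.
  rewrite ler_wpM2r// (bigD1 p)//= (bigD1 q)//= -addrA lerDl.
  by rewrite addr_ge0// sumr_ge0// => *; rewrite ?sumr_ge0.
rewrite mxE (le_trans (ler_norm_sum _ _ _))// /K mulr_suml ler_sum// => g _.
by rewrite /path_term normrM mulrAC ler_wpM2r// mulrC fP.
Qed.

End MatrixCalculus.

(** * Derivatives of resolvents and divided differences *)

Section ResolventDerivative.
Context {R : realType}.
Implicit Types (x y : R) (c : R^nat).

Lemma is_derive_quotient (f g : R -> R) y l :
  (\forall h \near 0^', f (h + y) - f y = h * g (h + y)) ->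
  g (h + y) @[h --> 0^'] --> l -> is_derive y 1 f l.
Proof.
move=> fg gl.
suff fl : (fun h => h^-1 *: ((f \o shift y) (h *: 1) - f y)) @ 0^' --> l.
  by apply: DeriveDef; [exact: cvgP fl|exact/cvg_lim].
apply: cvg_trans gl; apply: near_eq_cvg; near=> h.
have h0 : h != 0 by near: h; exact: nbhs_dnbhs_neq.
rewrite /= [h *: 1]mulr1 (_ : f (h + y) - f y = h * g (h + y)); last by near: h.
by rewrite [_ *: _]mulrA mulVf// mul1r.
Unshelve. all: by end_near. Qed.

(** By the resolvent identity the difference quotient is (E_(y+h) E_y c)_(j+1), which is continuous
    in h. *)
Lemma is_derive_resolvent c j y : `|y| < 1 -> bdd c ->
  is_derive y 1 (fun x => resolvent x c j) (resolvent y (resolvent y c) j.+1).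
Proof.
move=> y1 bc.
have hy : h + y @[h --> 0^'] --> y.
  rewrite -[X in _ --> X]add0r; apply: cvgD; last exact: cvg_cst.
  exact: nbhs_dnbhs.
apply: (@is_derive_quotient _ (fun x => resolvent x (resolvent y c) j.+1)).
  near=> h; rewrite resolvent_sub ?addrK//.
  by near: h; apply: (cvgr_lt _ (cvg_norm hy)).
apply: (ucvg_cvg (cs := fun h => resolvent (h + y) (resolvent y c))).
apply: ucvg_resolvent => //.
- by apply: nearW => _; exact: bdd_resolvent.
- exact: bdd_resolvent.
- exact: ucvg_cst.
Unshelve. all: by end_near. Qed.

Lemma foldr_resolventC c s y : bdd c -> {in s, forall x, `|x| < 1} -> `|y| < 1 ->
  foldr resolvent (resolvent y c) s = resolvent y (foldr resolvent c s).
Proof.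
move=> bc s1 y1; elim: s s1 => //= x s IH s1.
rewrite IH => [|z zs]; last by apply: s1; rewrite in_cons zs orbT.
apply: resolventC => //; first by apply: s1; rewrite mem_head.
by apply: bdd_foldr_resolvent => // z zs; apply: s1; rewrite in_cons zs orbT.
Qed.

(** Induction on k. The two shorter lists x :: b and b y share the middle part b, and commutation of
    resolvents lets y take the place of x in front of b. Each order contributes the slope - 1/M of x
    |-> 1 - x/M. *)
Lemma divdiff_foldr (f : R -> R) c (M : R) (k : nat) (a : seq R) : bdd c -> 0 < M ->
  (forall x, 0 < x < 2 * M -> f x = resolvent (1 - x / M) c 0) ->
  size a = k.+1 -> {in a, forall x, 0 < x < 2 * M} ->
  divdiff f k a =
    (- M^-1) ^+ k * foldr resolvent c [seq 1 - x / M | x <- a] k.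
Proof.
move=> bc M0 fE; pose sg x := 1 - x / M.
have sg1 x : 0 < x < 2 * M -> `|sg x| < 1.
  move=> /andP[x0 xM]; rewrite ltr_norml /sg.
  have /andP[] : 0 < x / M < 2 by rewrite divr_gt0//= ltr_pdivrMr.
  by move=> ? ?; apply/andP; split; lra.
elim: k a => [|k IH] a.
  case: a => [|x []]// _ aP; rewrite expr0 mul1r /= -fE//.
  by apply: aP; rewrite mem_head.
case: a => [|x a]//; case/lastP: a => [|b y]//.
rewrite /= size_rcons => -[bk] aP.
have xP : 0 < x < 2 * M by apply: aP; rewrite mem_head.
have yP : 0 < y < 2 * M by apply: aP; rewrite in_cons mem_rcons mem_head orbT.
have bP : {in b, forall z, 0 < z < 2 * M}.
  by move=> z zb; apply: aP; rewrite in_cons mem_rcons in_cons zb !orbT.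
pose B := foldr resolvent c (map sg b).
have bB : bdd B by apply: bdd_foldr_resolvent => // _ /mapP[z zb ->]; exact/sg1/bP.
have IHb z : 0 < z < 2 * M ->
    divdiff f k (z :: b) = (- M^-1) ^+ k * resolvent (sg z) B k.
  move=> zP; rewrite IH//= ?bk// => t; rewrite in_cons => /predU1P[->//|].
  exact: bP.
have rcons_cons : foldr resolvent c (map sg (rcons b y)) = resolvent (sg y) B.
  rewrite map_rcons foldr_rcons foldr_resolventC//; last exact: sg1.
  by move=> _ /mapP[z zb ->]; exact/sg1/bP.
have tb : take k (rcons b y) = b by rewrite -cats1 take_cat bk ltnn subnn take0 cats0.
rewrite tb last_rcons -/sg rcons_cons; case: eqP => [xy|/eqP xy].
  (* Confluent case: only the first argument varies, so the chain rule applies to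
     [is_derive_resolvent] at the fixed sequence [B]. *)
  subst y; rewrite derive1E; apply: (@derive_val _ _ _ _ _ _ _).
  pose h z := (- M^-1) ^+ k * resolvent (sg z) B k.
  apply: (@near_eq_is_derive _ _ _ h).
    near=> z; rewrite IHb//; near: z.
    have [x0 xM] := andP xP.
    by near=> z; apply/andP; split; near: z; [exact: lt_nbhsr|exact: lt_nbhsl].
  have dsg : is_derive x 1 sg (- M^-1).
    apply: (@is_derive_quotient _ (fun=> - M^-1)); last exact: cvg_cst.
    by apply: nearW => t; rewrite /sg; ring.
  have := is_deriveZ ((- M^-1) ^+ k)
    (is_derive1_comp (is_derive_resolvent k (sg1 _ xP) bB) dsg).
  by move=> dh; apply: (is_derive_eq dh); rewrite exprSr [LHS]mulrA mulrAC.
(* Distinct end points: the quotient is evaluated by the resolvent identity. *)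
rewrite IHb// IH ?size_rcons ?bk//; last first.
  by move=> z; rewrite mem_rcons in_cons => /predU1P[->//|/bP].
rewrite -/sg rcons_cons -mulrBr resolvent_sub//; [|exact: sg1..].
have xy0 : x - y != 0 by rewrite subr_eq0.
have -> : sg x - sg y = - M^-1 * (x - y) by rewrite /sg; field; rewrite gt_eqF.
by rewrite exprSr; field; rewrite xy0 gt_eqF.
Unshelve. all: by end_near. Qed.

End ResolventDerivative.

(** * Continuity and composition of the matrix calculus *)

Section FunctionalCalculus.
Context {R : realType} {n : nat}.
Implicit Types (S T X Z : 'M[R]_n) (c d : R^nat).
Implicit Types (a r b s : R).

Lemma foldr_resolvent_ucvg {I : Type} (F : set_system I) {FF : Filter F}
    (J : Type) (xs : I -> J -> R) (x : J -> R) c (g : seq J) : bdd c ->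
  (forall u, `|x u| < 1) -> (forall u, xs i u @[i --> F] --> x u) ->
  ucvg F (fun i => foldr resolvent c (map (xs i) g)) (foldr resolvent c (map x g)).
Proof.
move=> bc x1 xsx.
have xs1 u : \forall i \near F, `|xs i u| < 1.
  by have := cvgr_lt _ (cvg_norm (xsx u)); apply.
elim: g => [|u g IH] /=; first exact: ucvg_cst.
have bx (y : J -> R) (h : seq J) : (forall u, `|y u| < 1) ->
    bdd (foldr resolvent c (map y h)).
  by move=> y1; elim: h => //= ? ? ?; exact: bdd_resolvent.
apply: ucvg_resolvent => //; last exact: bx.
elim: g {IH} => [|v g IH] /=; first exact: nearW.
by near=> i; apply: bdd_resolvent; near: i.
Unshelve. all: by end_near. Qed.

Lemma mxcalc_cvg {I : Type} (F : set_system I) {FF : Filter F}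
    (Ss : I -> 'M[R]_n) S c m p q : bdd c -> sub_unit_diag S ->
  (forall p q, Ss i p q @[i --> F] --> S p q) ->
  mxcalc c (Ss i) m p q @[i --> F] --> mxcalc c S m p q.
Proof.
move=> bc [St S1] SsS; rewrite mxE; under eq_cvg do rewrite mxE.
apply: cvg_big => [|g _]; first exact: add_continuous.
apply: cvgM; last by apply: cvg_big => [|e _]; [exact: mul_continuous|exact: SsS].
apply: (ucvg_cvg (cs := fun i => foldr resolvent c [seq Ss i k k | k <- g])).
by apply: (@foldr_resolvent_ucvg _ _ _ _ (fun i k => Ss i k k) (fun k => S k k)).
Qed.

(* f((T - a) / r) *)
Definition mxcalc_at c a r T : 'M[R]_n := mxcalc c (r^-1 *: (T - a%:M)) 0.

Lemma affine_sub_unit_diag a r T : upper_triangular T ->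
  (forall i, `|r^-1 * (T i i - a)| < 1) ->
  sub_unit_diag (r^-1 *: (T - a%:M)).
Proof.
move=> /upper_triangularP Tt T1; split; last by move=> i; rewrite !mxE eqxx.
apply/upper_triangularP => i j ji.
by rewrite !mxE Tt// eqE /= gtn_eqF// subr0 mulr0.
Qed.

Lemma mxcalc_at_comm c a r T Z : bdd c -> upper_triangular T ->
  (forall i, `|r^-1 * (T i i - a)| < 1) ->
  Z *m T = T *m Z -> Z *m mxcalc_at c a r T = mxcalc_at c a r T *m Z.
Proof.
move=> bc Tt T1 ZT; apply: mxcalc_comm => //; first exact: affine_sub_unit_diag.
by rewrite -scalemxAr -scalemxAl mulmxBr mulmxBl ZT scalar_mxC.
Qed.

Lemma mxcalc_at_diag c a r T i :
  mxcalc_at c a r T i i = resolvent (r^-1 * (T i i - a)) c 0.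
Proof. by rewrite mxcalc_diag !mxE eqxx. Qed.

Lemma mxcalc_at_cvg {I : Type} (F : set_system I) {FF : Filter F}
    (Ts : I -> 'M[R]_n) T c a r p q : bdd c -> upper_triangular T ->
  (forall i, `|r^-1 * (T i i - a)| < 1) ->
  (forall p q, Ts i p q @[i --> F] --> T p q) ->
  mxcalc_at c a r (Ts i) p q @[i --> F] --> mxcalc_at c a r T p q.
Proof.
move=> bc Tt T1 TsT; apply: mxcalc_cvg => //; first exact: affine_sub_unit_diag.
move=> i j; rewrite !mxE; under eq_cvg do rewrite !mxE.
by apply: cvgMl_tmp; apply: cvgB => //; exact: cvg_cst.
Qed.

(** Put W = Z - T and argue by induction on q - p. All other terms of the (p, q) entry of W T = T W
    vanish, leaving W_pq T_qq = T_pp W_pq, and T_pp differs from T_qq. *)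
Lemma comm_upper_triangular_inj T Z : upper_triangular T -> upper_triangular Z ->
  Z *m T = T *m Z -> (forall i, Z i i = T i i) ->
  (forall i j, i != j -> T i i != T j j) -> Z = T.
Proof.
move=> Tt Zt ZT ZTd Tinj; apply/eqP; rewrite -subr_eq0; apply/eqP.
set W := Z - T.
have WT : W *m T = T *m W by rewrite mulmxBl mulmxBr ZT.
have Wt : upper_triangular W.
  apply/upper_triangularP => i j ji.
  by rewrite !mxE !(upper_triangularP _ _ _ _ ji)// subr0.
apply/matrixP => p q; rewrite [RHS]mxE.
have [d] := ubnP (q - p); elim: d => // d IH in p q *; rewrite ltnS => pqd.
have [qp|pq|] := ltngtP q p; first exact: (upper_triangularP _ Wt).
  have /(congr1 (fun M : 'M[R]_n => M p q)) := WT.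
  rewrite !upper_triangular_mulE// (bigD1 q) ?leqnn ?(ltnW pq)//=.
  rewrite [X in _ + X]big1 ?addr0; last first.
    move=> k /andP[/andP[pk kq] kneq]; rewrite IH ?mul0r//.
    apply: leq_trans pqd; rewrite ltn_sub2r// ?ltn_neqAle//.
    by rewrite -[X in X && _]/(k != q) kneq.
  rewrite (bigD1 p) ?leqnn ?(ltnW pq)//=.
  rewrite [X in _ + X]big1 ?addr0; last first.
    move=> k /andP[/andP[pk kq] kneq]; rewrite IH ?mulr0//.
    apply: leq_trans pqd; rewrite ltn_sub2l// ltn_neqAle pk andbT eq_sym.
    exact: kneq.
  move/eqP; rewrite mulrC -subr_eq0 -mulrBl mulf_eq0 subr_eq0 => /orP[|/eqP//].
  by rewrite (negbTE (Tinj q p _))// eqE /= gtn_eqF.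
by move=> /val_inj ->; rewrite !mxE ZTd subrr.
Qed.

(** Transfers a scalar identity g(f(x)) = x on an interval to g(f(T)) = T. The interval is open so
    that small perturbations of the diagonal stay inside it. *)
Lemma mxcalc_at_cancel c d a r b s (lo hi : R) T : bdd c -> bdd d ->
  upper_triangular T -> (forall i, lo < T i i < hi) ->
  (forall x, lo < x < hi -> `|r^-1 * (x - a)| < 1) ->
  (forall x, lo < x < hi -> `|s^-1 * (resolvent (r^-1 * (x - a)) c 0 - b)| < 1) ->
  (forall x, lo < x < hi ->
     resolvent (s^-1 * (resolvent (r^-1 * (x - a)) c 0 - b)) d 0 = x) ->
  mxcalc_at d b s (mxcalc_at c a r T) = T.
Proof.
move=> bc bd Tt Tlh H1 H2 H3.
have main X : upper_triangular X -> (forall i, lo < X i i < hi) ->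
    (forall i j, i != j -> X i i != X j j) ->
    mxcalc_at d b s (mxcalc_at c a r X) = X.
  move=> Xt Xlh Xinj; apply: comm_upper_triangular_inj => //.
  - exact: upper_triangular_mxcalc.
  - apply/esym/mxcalc_at_comm => //; first exact: upper_triangular_mxcalc.
      by move=> i; rewrite mxcalc_at_diag; exact: H2.
    by apply: mxcalc_at_comm => // i; exact: H1.
  - by move=> i; rewrite !mxcalc_at_diag H3.
(* Perturbing the diagonal makes its entries distinct; conclude by continuity. *)
pose Ts (e : R) : 'M[R]_n := T + e *: diag_mx (\row_(i < n) i%:R).
have Tst e : upper_triangular (Ts e).
  apply/upper_triangularP => i j ji; rewrite !mxE (upper_triangularP _ Tt)// add0r.
  by rewrite eqE /= gtn_eqF// mulr0.
have TsT p q : Ts e p q @[e --> 0^'] --> T p q.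
  rewrite -[X in _ --> X]addr0 -[X in _ --> _ + X](mul0r ((diag_mx (\row_(i < n) i%:R) : 'M[R]_n) p q)).
  rewrite /Ts; under eq_cvg do rewrite mxE [X in _ + X]mxE.
  apply: cvgD; first exact: cvg_cst.
  by apply: cvgMr_tmp; exact: nbhs_dnbhs.
have Tslh : \forall e \near 0^', forall i, lo < Ts e i i < hi.
  apply: filter_forall => i; have /andP[lT Th] := Tlh i.
  near=> e; apply/andP; split; near: e.
    exact: (cvgr_gt _ (TsT i i)).
  exact: (cvgr_lt _ (TsT i i)).
have Tsinj : \forall e \near 0^', forall i j, i != j -> Ts e i i != Ts e j j.
  apply: filter_forall => i; apply: filter_forall => j.
  have [->|ij] := eqVneq i j; first exact: nearW.
  (* Equal entries are separated by the distinct multiples of e; distinct ones stay distinct by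
     continuity. *)
  have [Tij|Tij] := eqVneq (T i i) (T j j).
    near=> e; move=> _; have e0 : e != 0 by near: e; exact: nbhs_dnbhs_neq.
    rewrite !mxE !eqxx Tij !mulr1n (inj_eq (addrI _)) (inj_eq (mulfI e0)).
    by rewrite eqr_nat.
  have /cvgr_neq0 : Ts e i i - Ts e j j @[e --> 0^'] --> T i i - T j j.
    by apply: cvgB; exact: TsT.
  rewrite subr_eq0 => /(_ Tij); apply: filterS => e; by rewrite subr_eq0.
apply/matrixP => p q.
apply: (@cvg_unique _ _ ((fun e => Ts e p q) @ 0^')) => //; last exact: TsT.
have : mxcalc_at d b s (mxcalc_at c a r (Ts e)) p q @[e --> 0^'] -->
       mxcalc_at d b s (mxcalc_at c a r T) p q.
  apply: mxcalc_at_cvg => //; first exact: upper_triangular_mxcalc.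
    by move=> i; rewrite mxcalc_at_diag; exact: H2.
  move=> i j; apply: mxcalc_at_cvg => // k; exact: H1.
apply: cvg_trans; apply: near_eq_cvg; near=> e.
by rewrite main//; near: e.
Unshelve. all: by end_near. Qed.

End FunctionalCalculus.

(** * The matrix exponential as an instance of the calculus *)

Section Exponential.
Context {R : realType} {n : nat}.
Implicit Types (S T Y : 'M[R]_n) (c : R^nat) (M : R).

(** Turns a large index into a tail of the coefficients, to which [mxcalc_bound] applies. *)
Lemma mxcalc_shift c S k m : bdd c -> sub_unit_diag S ->
  mxcalc c S (k + m) = mxcalc (seqshift k c) S m.
Proof.
move=> bc Su; apply/matrixP => p q; rewrite !mxE; apply: eq_bigr => g _.
rewrite /path_term; congr (_ * _).
suff -> : foldr resolvent (seqshift k c) [seq S i i | i <- g] =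
    seqshift k (foldr resolvent c [seq S i i | i <- g]).
  by rewrite /seqshift addnCA.
elim: (bseqval g) => //= i h ->; rewrite resolvent_shift//; first exact: Su.2.
exact: bdd_foldr_diag.
Qed.

(** The coefficient sequences of all monomials are bounded by 1, so the single constant of
    [mxcalc_bound] serves every power. *)
Lemma expmx_bound S : sub_unit_diag S ->
  exists2 K : R, 0 <= K & forall N p q, `|(S ^+ N) p q| <= K.
Proof.
move=> Su; have [K K0 KP] := mxcalc_bound Su; exists K => // N p q.
pose c : R^nat := fun k => (k == N)%:R.
have c1 k : `|c k| <= 1 by rewrite /c; case: eqP; rewrite ?normr1 ?normr0.
have bc : bdd c by exists 1.
have sN0 : mxcalc c S N.+1 = 0.
  apply/matrixP => i j; rewrite -[N.+1]addn0 mxcalc_shift// [RHS]mxE.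
  apply/eqP; rewrite -normr_le0 -(mulr0 K); apply: KP => k.
  by rewrite /seqshift /c gtn_eqF ?normr0// ltnS leq_addr.
(* S^N is itself f(S) for f x = x^N. *)
suff -> : S ^+ N = mxcalc c S 0 by rewrite -[K]mulr1; exact: KP.
rewrite (mxcalc_sum N.+1)// sN0 mulmx0 addr0 big_ord_recr /= {2}/c eqxx scale1r.
by rewrite big1 ?add0r// => k _; rewrite /c ltn_eqF ?scale0r.
Qed.

Lemma cvg_mx_entries (X : nat -> 'M[R]_n) Y :
  (forall p q, X N p q @[N --> \oo] --> Y p q) -> X @ \oo --> Y.
Proof.
move=> XY; apply/cvg_ballP => e e0.
have : \forall N \near \oo, forall p q, ball (Y p q) e (X N p q).
  apply: filter_forall => p; apply: filter_forall => q.
  by move/cvg_ballP: (XY p q); apply.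
by apply: filterS.
Qed.

(** The remainder in [mxcalc_sum] tends to 0: the powers of S stay bounded, and the calculus of the
    tail of c is small with the tail. *)
Lemma mxcalc_series c S : bdd c -> sub_unit_diag S -> c @ \oo --> 0 ->
  series (fun k => c k *: S ^+ k) @ \oo --> mxcalc c S 0.
Proof.
move=> bc Su c0; apply: cvg_mx_entries => p q.
have [K K0 KP] := mxcalc_bound Su; have [L L0 LP] := expmx_bound Su.
apply/cvgrPdist_le => e e0.
(* Chosen so that n L K C <= e; the added 1 keeps the denominator positive. *)
pose C := e / (n%:R * L * K + 1).
have den0 : 0 < n%:R * L * K + 1 by rewrite ltr_wpDl// !mulr_ge0.
have C0 : 0 < C by rewrite divr_gt0.
have [N0 _ cN] : \forall k \near \oo, `|c k| <= C.
  by move/cvgr0_norm_le: c0; apply.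
near=> N.
have N0N : (N0 <= N)%N by near: N; exact: nbhs_infty_ge.
have -> : mxcalc c S 0 = series (fun k => c k *: S ^+ k) N + S ^+ N *m mxcalc c S N.
  by rewrite (mxcalc_sum N)// /series /= big_mkord.
rewrite mxE addrAC subrr add0r mxE (le_trans (ler_norm_sum _ _ _))//.
apply: (@le_trans _ _ (\sum_(k < n) L * (K * C))).
  apply: ler_sum => k _; rewrite normrM ler_pM//.
  rewrite -[N in mxcalc _ _ N]addn0 mxcalc_shift//; apply: KP => t.
  by apply: cN; rewrite /= (leq_trans N0N)// leq_addr.
rewrite sumr_const card_ord -[_ *+ n]mulr_natl /C !mulrA.
by rewrite ler_pdivrMr// [leRHS]mulrC ler_wpM2r ?lerDl// ltW.
Unshelve. all: by end_near. Qed.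

(* Coefficients of s |-> exp (M s). *)
Definition exp_seq M : R^nat := fun k => M ^+ k / k`!%:R.

Lemma exp_seq_cvg M : exp_seq M @ \oo --> 0.
Proof. exact: cvg_exp_coeff. Qed.

Lemma bdd_exp_seq M : bdd (exp_seq M).
Proof.
have /cvgP/cvg_seq_bounded := @exp_seq_cvg M.
by move=> [C [_ CP]]; exists (C + 1) => j; apply: (CP (C + 1)); rewrite ?ltrDl.
Qed.

Lemma exp_resolvent M x : 0 < M -> resolvent (M^-1 * x) (exp_seq M) 0 = expR x.
Proof.
move=> M0; rewrite /resolvent /expR; congr (limn (series _)); apply/funext => i.
by rewrite /exp_seq /exp_coeff add0n exprMn exprVn mulrAC mulrA divff ?mul1r// expf_neq0// gt_eqF.
Qed.

(** Dividing by M brings the diagonal into the unit disk; the powers M^k in [exp_seq] undo the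
    rescaling. *)
Lemma expm_mxcalc M Y : 0 < M -> upper_triangular Y -> (forall i, `|Y i i| < M) ->
  expm Y = mxcalc_at (exp_seq M) 0 M Y.
Proof.
move=> M0 Yt YM; have M1 : M != 0 by rewrite gt_eqF.
have Su : sub_unit_diag (M^-1 *: (Y - 0%:M)).
  apply: affine_sub_unit_diag => // i.
  by rewrite subr0 normrM gtr0_norm ?invr_gt0// mulrC ltr_pdivrMr// mul1r.
rewrite /expm /mxcalc_at; apply/cvg_lim; first exact: norm_hausdorff.
have -> : (fun k => (k`!%:R)^-1 *: Y ^+ k) =
    (fun k => exp_seq M k *: (M^-1 *: (Y - 0%:M)) ^+ k).
  apply/funext => k; rewrite raddf0 subr0.
  have -> : (M^-1 *: Y) ^+ k = (M^-1) ^+ k *: Y ^+ k.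
    elim: k => [|k IH]; first by rewrite !expr0 scale1r.
    rewrite !exprS IH -[LHS]/(_ *m _) -[Y * _]/(Y *m _).
    by rewrite -scalemxAl -scalemxAr scalerA.
  by rewrite scalerA /exp_seq mulrAC -exprMn divff// expr1n mul1r.
by apply: mxcalc_series => //; [exact: bdd_exp_seq|exact: exp_seq_cvg].
Qed.

End Exponential.

(** * The scalar logarithm as a power series *)

Section Logarithm.
Context {R : realType}.
Implicit Types (M x y : R).

(* Coefficients of s |-> ln (M (1 - s)). *)
Definition log_seq M : R^nat := fun k => if k is 0 then ln M else - k%:R^-1.

Lemma bdd_log_seq M : bdd (log_seq M).
Proof.
exists (`|ln M| + 1) => -[|k]; first by rewrite lerDl.
by rewrite /= normrN gtr0_norm ?invr_gt0// ler_wpDl// invf_le1// ler1n.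
Qed.

(** By [is_derive_resolvent], the left side is the derivative at y of the series with coefficients
    [log_seq M]. *)
Lemma resolvent2_log_seq M y : `|y| < 1 ->
  resolvent y (resolvent y (log_seq M)) 1 = - (1 - y)^-1.
Proof.
move=> y1; set c := log_seq M; set E := resolvent y c.
have bc : bdd c := bdd_log_seq M.
have y10 : 1 - y != 0 by rewrite gt_eqF// subr_gt0 (le_lt_trans (ler_norm y)).
(* [h j] is sum_d (d + 1) c_(j+1+d) y^d, computed with
   (d + 1) / (j + 1 + d) = 1 - j / (j + 1 + d). *)
pose h : R^nat := fun j => - (1 - y)^-1 - j%:R * E j.+1.
have ED j : E j.+1 = - (j.+1%:R)^-1 + y * E j.+2 by rewrite [LHS]resolventE.
(* The factor j is absorbed by the coefficients: j / (j + 1 + t) <= 1. *)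
have bE : bdd (fun j => j%:R * E j.+1).
  exists (1 / (1 - `|y|)) => j.
  have -> : E j.+1 = resolvent y (seqshift j.+1 c) 0.
    by rewrite resolvent_shift// /seqshift addn0.
  have bs : bdd (seqshift j.+1 c) by exact: bdd_shift.
  have := resolventZ y1 j%:R bs => /(congr1 (fun f => f 0%N)) <-.
  apply: resolvent_bound => // t.
  rewrite /seqshift /c /= mulrN normrN ger0_norm ?divr_ge0//.
  by rewrite ler_pdivrMr// mul1r ler_nat addSn ltnW// ltnS leq_addr.
have -> : resolvent y E 1 = resolvent y (seqshift 1 E) 0.
  by rewrite resolvent_shift//; exact: bdd_resolvent.
rewrite -(@resolvent_uniq _ _ y1 _ h).
- by rewrite /h mul0r subr0.
- by apply/bdd_shift/bdd_resolvent.
- by apply: bddB => //; exists `|- (1 - y)^-1|.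
move=> j; rewrite /h /seqshift add1n ED.
have j0 : j.+1%:R != 0 :> R by rewrite pnatr_eq0.
by rewrite -[in RHS]natr1; field; rewrite natr1 j0 y10.
Qed.

(** The difference of the two sides has zero derivative on ]0, 2M[, hence is constant there by the
    mean value theorem. *)
Lemma log_resolvent M x : 0 < M -> 0 < x < 2 * M ->
  resolvent (1 - x / M) (log_seq M) 0 = ln x.
Proof.
move=> M0 xM.
pose s x := 1 - x / M.
have s1 z : 0 < z < 2 * M -> `|s z| < 1.
  move=> /andP[z0 zM]; rewrite ltr_norml /s.
  have /andP[] : 0 < z / M < 2 by rewrite divr_gt0//= ltr_pdivrMr.
  by move=> ? ?; apply/andP; split; lra.
pose f z := resolvent (s z) (log_seq M) 0 - ln z.
have df z : 0 < z < 2 * M -> is_derive z 1 f 0.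
  move=> zM; have [z0 _] := andP zM.
  have ds : is_derive z 1 s (- M^-1).
    apply: (@is_derive_quotient _ _ (fun=> - M^-1)); last exact: cvg_cst.
    by apply: nearW => t; rewrite /s; ring.
  have dr := is_derive1_comp (is_derive_resolvent 0 (s1 _ zM) (bdd_log_seq M)) ds.
  have dl := is_derive1_ln z0.
  have := is_deriveB dr dl; move=> d; apply: (is_derive_eq d).
  rewrite resolvent2_log_seq; last exact: s1.
  by rewrite /s; field; rewrite !gt_eqF//= subKr gt_eqF// divr_gt0.
have MM : 0 < M < 2 * M by rewrite M0/= ltr_pMl// ltr1n.
have f0 z : 0 < z < 2 * M -> {for z, continuous f}.
  by move=> /df[dz _]; apply/differentiable_continuous/derivable1_diffP.
have fE z t : 0 < z < 2 * M -> 0 < t < 2 * M -> z <= t -> f z = f t.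
  move=> /andP[z0 _] /andP[_ tM] zt.
  have zutM u : u \in `[z, t] -> 0 < u < 2 * M.
    by rewrite in_itv /= => /andP[zu ut]; rewrite (lt_le_trans z0)//= (le_lt_trans ut).
  have zutM' u : u \in `]z, t[ -> 0 < u < 2 * M.
    by move=> uzt; apply: zutM; exact: subset_itv_oo_cc uzt.
  have [| |u _ E] := MVT_segment (f := f) (df := fun=> 0) zt.
  - by move=> u /zutM'/df.
  - apply: continuous_in_subspaceT => u; rewrite inE => /zutM; exact: f0.
  by apply/esym/subr0_eq; rewrite E; exact: mul0r.
(* At the centre M the resolvent has parameter 0 and both terms equal [ln M]. *)
suff : f x = f M.
  rewrite /f /s divff ?gt_eqF// subrr => /eqP.
  rewrite [resolvent 0 _ _]resolventE ?normr0//; last exact: bdd_log_seq.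
  by rewrite mul0r addr0 subrr subr_eq0 => /eqP.
by have [xlM|Mlx] := leP x M; [apply: fE|apply/esym/fE => //; exact: ltW].
Qed.

End Logarithm.

(** * The matrix logarithm and its path formula *)

Section MatrixLogarithm.
Context {R : realType} {n : nat}.
Implicit Types (A B S : 'M[R]_n) (M x : R).

(** The negative scale [- M] makes the argument 1 - x/M, the variable of [log_seq M]. *)
Definition log_calc M A : 'M[R]_n := mxcalc_at (log_seq M) M (- M) A.

Lemma log_calc_arg M x : M != 0 -> (- M)^-1 * (x - M) = 1 - x / M.
Proof. by move=> M0; field. Qed.

Lemma log_calc_lt1 M x : 0 < M -> 0 < x < 2 * M -> `|(- M)^-1 * (x - M)| < 1.
Proof.
move=> M0 /andP[x0 xM]; rewrite log_calc_arg ?gt_eqF// ltr_norml.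
have /andP[] : 0 < x / M < 2 by rewrite divr_gt0//= ltr_pdivrMr.
by move=> ? ?; apply/andP; split; lra.
Qed.

Lemma log_calc_scalar M x : 0 < M -> 0 < x < 2 * M ->
  resolvent ((- M)^-1 * (x - M)) (log_seq M) 0 = ln x.
Proof. by move=> M0 xM; rewrite log_calc_arg ?gt_eqF// log_resolvent. Qed.

Lemma upper_triangular_expm B : upper_triangular B ->
  upper_triangular (expm B) /\ forall i, expm B i i = expR (B i i).
Proof.
move=> Bt.
have [M [M0 BM]] : exists M : R, 0 < M /\ forall i, `|B i i| < M.
  exists (1 + \sum_i `|B i i|); split; first by rewrite ltr_pwDl// sumr_ge0.
  by move=> i; rewrite (bigD1 i)//= addrCA ltrDl ltr_pwDl// sumr_ge0.
rewrite (expm_mxcalc M0 Bt BM); split; first exact: upper_triangular_mxcalc.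
by move=> i; rewrite mxcalc_at_diag subr0 exp_resolvent.
Qed.

Lemma log_calcK M A : 0 < M -> UT A -> (forall i, A i i < M) ->
  expm (log_calc M A) = A.
Proof.
move=> M0 [At A0] AM.
have [lo [lo0 loA]] : exists lo : R, 0 < lo /\ forall i, lo < A i i.
  have : \forall e \near 0^'+, 0 < e /\ forall i, e < A i i.
    near=> e; split; near: e; first exact: nbhs_right_gt.
    by apply: filter_forall => i; exact: nbhs_right_lt.
  by move/filter_ex => [e []]; exists e.
(* Exceeds |ln x| for lo < x < M, so that the logarithm lands in the domain of the rescaled
   exponential. *)
pose M1 := 1 + `|ln lo| + `|ln M|.
have M10 : 0 < M1 by rewrite /M1 -addrA ltr_pwDl// addr_ge0.
have in2M x : lo < x < M -> 0 < x < 2 * M.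
  by move=> /andP[lx xM]; rewrite (lt_trans lo0)//= (lt_trans xM)// ltr_pMl// ltr1n.
have lnM1 x : lo < x < M -> `|ln x| < M1.
  move=> /andP[lx xM]; have x0 := lt_trans lo0 lx.
  have l1 : ln lo < ln x by rewrite ltr_ln.
  have l2 : ln x < ln M by rewrite ltr_ln.
  rewrite ltr_norml /M1; have := ler_norm (- ln lo); rewrite normrN.
  have := ler_norm (ln M).
  have := normr_ge0 (ln lo); have := normr_ge0 (ln M).
  by move=> ? ? ? ?; apply/andP; split; lra.
rewrite (@expm_mxcalc _ _ M1) ?upper_triangular_mxcalc//; last first.
  move=> i; rewrite mxcalc_at_diag log_calc_scalar// ?in2M//; last exact/andP.
  by apply: lnM1; exact/andP.
apply: (mxcalc_at_cancel (lo := lo) (hi := M)) => //.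
- exact: bdd_log_seq.
- exact: bdd_exp_seq.
- by move=> i; exact/andP.
- by move=> x /in2M; exact: log_calc_lt1.
- move=> x xlh; rewrite log_calc_scalar// ?in2M// subr0 normrM normfV (gtr0_norm M10).
  by rewrite mulrC ltr_pdivrMr// mul1r lnM1.
- move=> x xlh; rewrite log_calc_scalar// ?in2M// subr0 exp_resolvent// lnK//.
  by case/andP: (in2M _ xlh).
Unshelve. all: by end_near. Qed.

Lemma expmK M B : 0 < M -> upper_triangular B -> (forall i, expR (B i i) < M) ->
  log_calc M (expm B) = B.
Proof.
move=> M0 Bt BM.
(* Dominates the diagonal of B and also [ln M], so |x| < M1 on the whole interval ]-M1, ln M[. *)
pose M1 := 1 + `|ln M| + \sum_i `|B i i|.
have M10 : 0 < M1 by rewrite /M1 -addrA ltr_pwDl// addr_ge0// sumr_ge0.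
have BM1 i : `|B i i| < M1.
  rewrite /M1 (bigD1 i)//= addrCA ltrDl -addrA ltr_pwDl// addr_ge0// sumr_ge0//.
have lnM : ln M < M1.
  rewrite (le_lt_trans (ler_norm _))// /M1 -addrA addrCA ltrDl ltr_pwDl// sumr_ge0//.
have in2M x : - M1 < x < ln M -> 0 < expR x < 2 * M.
  move=> /andP[_ xM]; rewrite expR_gt0/= (@lt_trans _ _ M)//.
    by rewrite -[ltRHS]lnK// ltr_expR.
  by rewrite ltr_pMl// ltr1n.
rewrite (expm_mxcalc M10 Bt BM1).
apply: (mxcalc_at_cancel (lo := - M1) (hi := ln M)) => //.
- exact: bdd_exp_seq.
- exact: bdd_log_seq.
- move=> i; have := BM1 i; rewrite ltr_norml => /andP[-> _] /=.
  by rewrite -ltr_expR lnK.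
- move=> x /andP[x1 x2]; rewrite subr0 normrM normfV (gtr0_norm M10).
  by rewrite mulrC ltr_pdivrMr// mul1r ltr_norml x1/= (lt_trans x2).
- by move=> x xlh; rewrite subr0 exp_resolvent// log_calc_lt1// in2M.
- by move=> x xlh; rewrite subr0 exp_resolvent// log_calc_scalar ?in2M// expRK.
Qed.

(** [log_calcK] provides a preimage of A and [expmK] shows it is the only one, so the default value
    of [logm] is not taken. *)
Lemma logm_log_calc M A : 0 < M -> UT A -> (forall i, A i i < M) ->
  logm A = log_calc M A.
Proof.
move=> M0 UA AM; apply: xget_subset1.
  by split; [exact: upper_triangular_mxcalc|exact: log_calcK].
suff uniqB B : upper_triangular B -> expm B = A -> B = log_calc M A.
  by move=> B C [Bt BA] [Ct CA]; rewrite (uniqB _ Bt BA) (uniqB _ Ct CA).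
move=> Bt BA; rewrite -BA expmK// => i.
by rewrite -(upper_triangular_expm Bt).2 BA.
Qed.

Lemma diag_lt A : exists M : R, 0 < M /\ forall i, A i i < M.
Proof.
exists (1 + \sum_i `|A i i|); split; first by rewrite ltr_pwDl// sumr_ge0.
move=> i; rewrite (le_lt_trans (ler_norm _))// (bigD1 i)//= addrCA ltrDl.
by rewrite ltr_pwDl// sumr_ge0.
Qed.

Lemma UT_lt2M M A : 0 < M -> UT A -> (forall i, A i i < M) ->
  forall i, 0 < A i i < 2 * M.
Proof.
move=> M0 [_ A0] AM i; rewrite A0/= (lt_trans (AM i))//.
by rewrite ltr_pMl// ltr1n.
Qed.

Lemma upper_triangular_logm A : UT A ->
  upper_triangular (logm A) /\ forall i, logm A i i = ln (A i i).
Proof.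
move=> UA; have [M [M0 AM]] := diag_lt A.
rewrite (logm_log_calc M0 UA AM); split; first exact: upper_triangular_mxcalc.
by move=> i; rewrite mxcalc_at_diag log_calc_scalar// UT_lt2M.
Qed.

Lemma upper_triangular_powm A t : UT A ->
  upper_triangular (powm A t) /\ forall i, powm A t i i = expR (t * ln (A i i)).
Proof.
move=> /upper_triangular_logm[Lt Ld].
have Lt' : upper_triangular (t *: logm A).
  by apply/upper_triangularP => i j ji; rewrite mxE (upper_triangularP _ Lt)// mulr0.
have [Et Ed] := upper_triangular_expm Lt'.
by split=> // i; rewrite /powm Ed mxE Ld.
Qed.

Lemma prod_path_scale a S A (g : seq 'I_n) :
  (forall i j : 'I_n, (i < j)%N -> S i j = a * A i j) ->
  sorted (fun i j : 'I_n => (i < j)%N) g ->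
  prod_path S g = a ^+ path_length g * prod_path A g.
Proof.
move=> SA; case: g => [_|i g]; first by rewrite /prod_path !big_nil mulr1.
elim: g i => [|j g IH] i /=; first by rewrite !prod_path1 mulr1.
case/andP=> ij jg; rewrite !(@prod_path_cons _ _ _ i j (j :: g))// SA//.
by rewrite (IH j)// /path_length /= exprS; ring.
Qed.

(** Rescaling the edges of a path of length k gives (- 1/M)^k, exactly the factor in
    [divdiff_foldr]; hence M disappears. *)
Lemma logm_paths A p q : UT A ->
  logm A p q = \sum_(g in paths p q) log_path A g * prod_path A g.
Proof.
move=> UA; have [M [M0 AM]] := diag_lt A.
have M1 : M != 0 by rewrite gt_eqF.
have A2M := UT_lt2M M0 UA AM.
rewrite (logm_log_calc M0 UA AM) mxE; apply: eq_bigr => g.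
rewrite inE => /and3P[gs /eqP gp _].
rewrite /path_term (@prod_path_scale (- M^-1) _ A)//; last first.
  by move=> i j ij; rewrite !mxE eqE /= ltn_eqF// subr0 invrN.
rewrite /log_path (@divdiff_foldr _ _ (log_seq M) M)//.
- rewrite addn0 -map_comp mulrCA mulrA; congr (_ * _ * _).
  set s1 := map _ _; set s2 := map _ _; suff -> : s1 = s2 by [].
  by apply: eq_map => i /=; rewrite !mxE eqxx mulr1n log_calc_arg.
- exact: bdd_log_seq.
- by move=> x xM; rewrite log_resolvent.
- by rewrite size_map /path_length; case: (bseqval g) gp.
- by move=> _ /mapP[i _ ->].
Qed.

End MatrixLogarithm.

(** * Triangular inverses and truncated blocks *)

Section TriangularInverse.
Context {R : realType} {n : nat}.
Implicit Types (A B X Y Z N : 'M[R]_n).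

Lemma UT_unitmx X : UT X -> X \in unitmx.
Proof.
move=> [Xt X0]; rewrite unitmxE -det_tr det_trig// unitfE.
by apply/prodf_neq0 => i _; rewrite mxE gt_eqF.
Qed.

Lemma UT_mul X Y : UT X -> UT Y -> UT (X *m Y).
Proof.
move=> [Xt X0] [Yt Y0]; split; first exact: upper_triangular_mul.
by move=> i; rewrite upper_triangular_mul_diag// mulr_gt0.
Qed.

(** Below the diagonal, row i of X X^-1 = 1 expresses the entries of the inverse through lower rows,
    which vanish by induction from the bottom. *)
Lemma UT_invmx X : UT X -> UT (invmx X) /\ forall i, invmx X i i = (X i i)^-1.
Proof.
move=> UX; have [Xt X0] := UX; have XV := mulmxV (UT_unitmx UX).
have Vt : upper_triangular (invmx X).
  apply/upper_triangularP => i j ji.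
  have [d] := ubnP (n - i); elim: d => // d IH in i ji *; rewrite ltnS => id.
  have /(congr1 (fun M : 'M[R]_n => M i j)) := XV; rewrite !mxE (bigD1 i)//= big1.
    by rewrite addr0 eqE /= gtn_eqF// => /eqP; rewrite mulf_eq0 gt_eqF//= => /eqP.
  move=> k ki; have [lki|ilk] := ltnP k i.
    by rewrite (upper_triangularP _ Xt)// mul0r.
  have ik : (i < k)%N by rewrite ltn_neqAle ilk eq_sym andbT; exact: ki.
  rewrite IH ?mulr0// ?(ltn_trans ji)//.
  by apply: leq_trans id; apply: ltn_sub2l.
have Vd i : invmx X i i = (X i i)^-1.
  have /(congr1 (fun M : 'M[R]_n => M i i)) := XV.
  rewrite upper_triangular_mul_diag// mxE eqxx => XVi.
  by rewrite -[LHS]mul1r -[in LHS](@mulVf _ (X i i)) ?gt_eqF// -mulrA XVi mulr1.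
by split=> //; split=> // i; rewrite Vd invr_gt0.
Qed.

Lemma unipotent_UT X : unipotent X -> UT X.
Proof. by move=> [Xt X1]; split=> // i; rewrite X1. Qed.

Lemma eq_prod_path A B (l : nat) (p : 'I_n) (g : seq 'I_n) :
  (forall i j : 'I_n, (p <= i)%N -> (i < j)%N -> (j <= l)%N -> A i j = B i j) ->
  path (fun i j : 'I_n => (i < j)%N) p g -> (last p g <= l)%N ->
  prod_path A (p :: g) = prod_path B (p :: g).
Proof.
elim: g p => [|k g IH] p AB /=; first by rewrite !prod_path1.
move=> /andP[pk kg] gl; rewrite !(@prod_path_cons _ _ _ p k (k :: g))//.
rewrite AB//; last exact: leq_trans (path_le kg) gl.
congr (_ * _); apply: IH => // i j ki; apply: AB.
exact: leq_trans (ltnW pk) ki.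
Qed.

(** * Dependence of B = X^-1 N on the corner entry X_pq, with C = Z^-1 N and Z the truncation of
    X *)

Section Block.
Variables (X Z B C : 'M[R]_n) (p q : 'I_n).
Hypotheses (uX : unipotent X) (uZ : unipotent Z).
Hypotheses (Bt : upper_triangular B) (Ct : upper_triangular C).
Hypotheses (pq : (p < q)%N) (XB : X *m B = Z *m C).
Hypothesis XZ : forall i j : 'I_n,
  (p <= i)%N -> (i < j)%N -> (j <= q)%N -> (i, j) != (p, q) -> X i j = Z i j.

Let entry Y W (i j : 'I_n) : unipotent Y -> upper_triangular W -> (i <= j)%N ->
  (Y *m W) i j = W i j + \sum_(k : 'I_n | (i <= k <= j)%N && (k != i)) Y i k * W k j.
Proof.
move=> [Yt Y1] Wt ij; rewrite upper_triangular_mulE// (bigD1 i)/=; last by rewrite leqnn.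
by rewrite Y1 mul1r.
Qed.

(** Induction from the bottom row: the (i, j) entry of X B = Z C determines B_ij from lower rows and
    from entries of X other than the corner. *)
Lemma block_eq (i j : 'I_n) : (p <= i)%N -> (i <= j)%N -> (j <= q)%N ->
  (i, j) != (p, q) -> B i j = C i j.
Proof.
move=> pi ij jq ijpq.
have [d] := ubnP (n - i); elim: d => // d IH in i pi ij ijpq *; rewrite ltnS => id.
have /(congr1 (fun M : 'M[R]_n => M i j)) := XB.
rewrite !entry//; set b := \sum_(_ | _) _; set c := \sum_(_ | _) _.
suff -> : b = c by move/addIr.
apply: eq_bigr => k /andP[/andP[ik kj] ki].
have ltik : (i < k)%N by rewrite ltn_neqAle ik eq_sym andbT; exact: ki.
have kq := leq_trans kj jq.
rewrite XZ//; last first.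
  apply: contra ijpq => /eqP[-> kE]; rewrite xpair_eqE eqxx/=.
  by rewrite -val_eqE /= eqn_leq jq -kE kj.
rewrite IH// ?(leq_trans pi)//.
  by rewrite xpair_eqE negb_and -val_eqE /= gtn_eqF// (leq_ltn_trans pi).
by apply: leq_trans id; apply: ltn_sub2l.
Qed.

(** In the (p, q) entry of X B = Z C only the term k = q differs: it is X_pq B_qq on the left and 0
    on the right. *)
Lemma block_corner : Z p q = 0 -> B p q = C p q - X p q * C q q.
Proof.
move=> Zpq; have /(congr1 (fun M : 'M[R]_n => M p q)) := XB.
have pq' := ltnW pq; have pqn : q != p by rewrite -val_eqE /= gtn_eqF.
rewrite !entry// (bigD1 q) ?pqn ?pq' ?leqnn//= [in RHS](bigD1 q) ?pqn ?pq' ?leqnn//=.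
rewrite Zpq mul0r add0r [B q q]block_eq ?pq'//; last by rewrite xpair_eqE negb_and pqn.
set b := \sum_(_ | _) _; set c := \sum_(_ | _) _.
suff -> : b = c by rewrite addrA => /addIr <-; rewrite addrK.
apply: eq_bigr => k /andP[/andP[/andP[pk kq] kp] kneq].
have ltpk : (p < k)%N by rewrite ltn_neqAle pk eq_sym andbT; exact: kp.
rewrite XZ// ?block_eq// xpair_eqE negb_and ?kp//.
by rewrite kneq orbT.
Qed.

(** A path through an intermediate vertex never uses the (p, q) entry, so only the one-step path
    feels the change. *)
Lemma block_path_sum (L : seq 'I_n -> R) : Z p q = 0 ->
  \sum_(g in paths p q) L g * prod_path B g =
  \sum_(g in paths p q) L g * prod_path C g - L [:: p; q] * (X p q * C q q).
Proof.
move=> Zpq.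
rewrite (@big_paths_step _ _ _ _ (fun g => L g * prod_path B g))//.
rewrite (@big_paths_step _ _ _ _ (fun g => L g * prod_path C g))//.
rewrite (bigD1 q)//= [in RHS](bigD1 q)//=.
rewrite (@big_paths_refl _ _ _ (fun g => L (p :: g) * prod_path B (p :: g))).
rewrite (@big_paths_refl _ _ _ (fun g => L (p :: g) * prod_path C (p :: g))).
rewrite !(@prod_path_cons _ _ _ p q [:: q])// !prod_path1 !mulr1 block_corner//.
rewrite mulrBr addrAC; congr (_ + _ - _).
apply: eq_bigr => k /andP[pk kq]; apply: eq_bigr => g.
rewrite inE; case: (bseqval g) => [|l h]/=; first by [].
move=> /and3P[lh /eqP[lk] /eqP hq]; rewrite {l}lk in lh hq *; congr (_ * _).
have kleq : (k <= q)%N by rewrite -hq path_le.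
rewrite !(@prod_path_cons _ _ _ p k (k :: h))// block_eq ?(ltnW pk)//; last first.
  by rewrite xpair_eqE negb_and kq orbT.
congr (_ * _); apply: (@eq_prod_path _ _ q) => //; last by rewrite hq.
move=> i j ki ij jq; apply: block_eq => //; last 2 first.
- exact: ltnW.
- by rewrite xpair_eqE negb_and -val_eqE /= gtn_eqF// (leq_trans pk).
exact: leq_trans (ltnW pk) ki.
Qed.

End Block.

Lemma truncated_block_unipotent X p q : unipotent (truncated_block X p q).
Proof.
split; last by move=> i; rewrite mxE eqxx.
apply/upper_triangularP => i j ji; rewrite mxE eqE /= gtn_eqF//.
by rewrite [(i < j)%N]ltnNge (ltnW ji) andbF.
Qed.

(** The truncation sees only entries strictly closer to the diagonal than (p, q), which makes the
    recursion well founded. *)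
Lemma eq_truncated_block X Y (p q : 'I_n) :
  (forall i j : 'I_n, (i < j)%N -> (j - i < q - p)%N -> X i j = Y i j) ->
  truncated_block X p q = truncated_block Y p q.
Proof.
move=> XY; apply/matrixP => i j; rewrite !mxE; case: eqP => // _.
case: ifP => // /and4P[pi ij jq ijpq]; apply: XY => //.
have [jq'|jq'] := eqVneq j q.
  rewrite -jq' in ijpq *; apply: ltn_sub2l => //; first exact: leq_ltn_trans pi ij.
  rewrite ltn_neqAle pi andbT eq_sym; move: ijpq.
  by rewrite xpair_eqE eqxx andbT.
apply: (@leq_ltn_trans (j - p)); first exact: leq_sub2l.
apply: ltn_sub2r; last by rewrite ltn_neqAle jq andbT; exact: jq'.
by rewrite (leq_ltn_trans pi)// (leq_trans ij).
Qed.

End TriangularInverse.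

Lemma divdiff_ln_gt0 {R : realType} (a b : R) : 0 < a -> 0 < b ->
  0 < divdiff (@ln R) 1 [:: a; b].
Proof.
move=> a0 b0 /=; case: eqP => [_|/eqP ab].
  rewrite derive1E; have -> : 'D_1 (fun x : R => ln x) a = a^-1.
    by apply: (@derive_val _ _ _ _ _ _ _); exact: is_derive1_ln.
  by rewrite invr_gt0.
have [lab|lba|E] := ltgtP a b; last by rewrite E eqxx in ab.
  by rewrite nmulr_rgt0 ?invr_lt0 ?subr_lt0 ?ltr_ln.
by rewrite divr_gt0 ?subr_gt0 ?ltr_ln.
Qed.

(** * The Karcher equation and its entrywise recursion *)

Section KarcherRecursion.
Context {R : realType} {m n : nat}.
Variables (w : 'I_m -> R) (A : 'I_m -> 'M[R]_n).
Hypotheses (w01 : forall i, 0 < w i < 1) (w_sum : \sum_(i < m) w i = 1).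
Hypothesis A_UT : forall i, UT (A i).
Implicit Types (X Y : 'M[R]_n) (p q : 'I_n).

Local Notation D := (karcher_diag w A).
Local Notation N := (normalized w A).
Local Notation c_ := (karcher_coef w A).

Let log_mean p := \sum_(i < m) w i * ln (A i p p).

(** Diagonals of triangular matrices multiply, so D carries the weighted geometric means of the
    diagonal entries. *)
Lemma karcher_diagE p q : D p q = expR (log_mean p) *+ (p == q).
Proof.
rewrite mxE mxE; congr (_ *+ _).
suff [] : upper_triangular (\prod_(i < m) powm (A i) (w i)) /\
  forall p, (\prod_(i < m) powm (A i) (w i)) p p = expR (log_mean p) by [].
rewrite /log_mean; elim: (index_enum _) => [|i s [IHt IHd]].
  split=> [|j]; last by rewrite !big_nil mxE eqxx expR0.
  by apply/upper_triangularP => j k kj; rewrite big_nil mxE eqE /= gtn_eqF.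
have [Pt Pd] := upper_triangular_powm (w i) (A_UT i).
rewrite big_cons -[_ * _]/(_ *m _); split; first exact: upper_triangular_mul.
by move=> j; rewrite upper_triangular_mul_diag// Pd IHd big_cons expRD.
Qed.

Lemma karcher_diag_UT : UT D.
Proof.
split=> [|i]; last by rewrite karcher_diagE eqxx expR_gt0.
by apply/upper_triangularP => i j ji; rewrite karcher_diagE eqE /= gtn_eqF.
Qed.

Lemma normalized_UT i : UT (N i).
Proof. by apply: UT_mul => //; case: (UT_invmx karcher_diag_UT). Qed.

Lemma karcher_coef_gt0 p q : 0 < c_ p q.
Proof.
(* Weights with sum 1 force m > 0, so the sum of positive terms is nonempty. *)
have [i0 _] : exists i0 : 'I_m, true.
  case: (m) w w_sum => [w'|m' _ _]; last by exists ord0.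
  by rewrite big_ord0 => /eqP; rewrite eq_sym oner_eq0.
have pos i : 0 < w i * N i q q * divdiff (@ln R) 1 [:: N i p p; N i q q].
  have [_ N0] := normalized_UT i; have /andP[w0 _] := w01 i.
  by rewrite !mulr_gt0// divdiff_ln_gt0.
by rewrite /karcher_coef (bigD1 i0)//= ltr_pwDl// sumr_ge0// => i _; exact: ltW.
Qed.

Definition karcher_rhs X p q : R := 1 / c_ p q *
  \sum_(i < m) w i * (\sum_(g in paths p q) log_path (N i) g *
     prod_path (invmx (truncated_block X p q) *m N i) g).

(** A map whose fixed points solve the recursion, so that existence and uniqueness follow by
    iterating it. *)
Definition karcher_step X : 'M[R]_n :=
  \matrix_(p, q) if (p < q)%N then karcher_rhs X p q else (p == q)%:R.

Lemma karcher_recursion_step X : karcher_recursion w A X <-> karcher_step X = X.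
Proof.
split=> [[[/upper_triangularP Xt X1] XE]|XE].
  apply/matrixP => p q; rewrite mxE; case: ltngtP => [/XE//|qp|/val_inj ->].
    by rewrite Xt// eqE /= gtn_eqF.
  by rewrite eqxx X1.
split; last by move=> p q pq; rewrite -[in LHS]XE mxE pq.
split; last by move=> p; rewrite -XE mxE ltnn eqxx.
apply/upper_triangularP => p q qp.
by rewrite -XE mxE ltnNge (ltnW qp) eqE /= gtn_eqF.
Qed.

(** Each step settles one more superdiagonal; after n steps nothing depends on the starting
    matrix. *)
Lemma iter_karcher_step X Y (d : nat) p q : (q - p < d)%N ->
  iter d karcher_step X p q = iter d karcher_step Y p q.
Proof.
elim: d p q => // d IH p q; rewrite ltnS => pqd; rewrite !iterS !mxE.
case: ifP => // pq; rewrite /karcher_rhs (eq_truncated_block (Y := iter d karcher_step Y))//.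
by move=> i j ij ijpq; apply: IH; exact: leq_trans pqd.
Qed.

Lemma karcher_recursion_unique : exists X, unique (karcher_recursion w A) X.
Proof.
have iterC X Y : iter n karcher_step X = iter n karcher_step Y.
  apply/matrixP => p q; apply: iter_karcher_step.
  exact: leq_ltn_trans (leq_subr _ _) (ltn_ord q).
exists (iter n karcher_step 0); split.
  by apply/karcher_recursion_step; rewrite -iterS iterSr; exact: iterC.
move=> X /karcher_recursion_step XE.
have iterX d : iter d karcher_step X = X by elim: d => //= d ->.
by rewrite (iterC _ X).
Qed.

(** Since X is unipotent, X^-1 N_i has the diagonal of N_i and hence the same divided differences.
    By [block_path_sum], passing to the truncated block then isolates X_pq with coefficient -
    c_pq. *)
Lemma karcher_entry X p q : unipotent X -> (p < q)%N ->
  (\sum_(i < m) w i *: logm (invmx X *m N i)) p q =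
  c_ p q * (karcher_rhs X p q - X p q).
Proof.
move=> uX pq; have UX := unipotent_UT uX.
have [UV Vd] := UT_invmx UX.
rewrite mulrBr /karcher_rhs mulrA mul1r divff ?mul1r ?gt_eqF ?karcher_coef_gt0//.
rewrite summxE /karcher_coef mulr_suml -sumrB; apply: eq_bigr => i _.
have NU := normalized_UT i; rewrite mxE.
have BU : UT (invmx X *m N i) by exact: UT_mul.
rewrite logm_paths//.
set Z := truncated_block X p q.
have uZ : unipotent Z := truncated_block_unipotent X p q.
have [UZV ZVd] := UT_invmx (unipotent_UT uZ).
have CU : UT (invmx Z *m N i) by exact: UT_mul.
have Cd k : (invmx Z *m N i) k k = N i k k.
  by rewrite upper_triangular_mul_diag ?ZVd ?uZ.2 ?invr1 ?mul1r//; [case: UZV|case: NU].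
have logB g : log_path (invmx X *m N i) g = log_path (N i) g.
  rewrite /log_path; congr divdiff; apply: eq_map => k.
  by rewrite upper_triangular_mul_diag ?Vd ?uX.2 ?invr1 ?mul1r//; [case: UV|case: NU].
under eq_bigr do rewrite logB.
rewrite (@block_path_sum _ _ X Z (invmx X *m N i) (invmx Z *m N i))//.
- rewrite Cd -[log_path _ [:: p; q]]/(divdiff _ 1 [:: N i p p; N i q q]).
  by ring.
- by case: BU.
- by case: CU.
- by rewrite !mulKVmx// UT_unitmx//; exact: unipotent_UT.
- move=> k l pk kl lq klpq; rewrite mxE pk kl lq klpq.
  by rewrite -val_eqE /= ltn_eqF.
- by rewrite mxE eqxx !andbF -val_eqE /= ltn_eqF.
Qed.

(** Above the diagonal this is [karcher_entry] with c_pq nonzero; below it, logarithms of triangular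
    matrices vanish. *)
Lemma karcher_equation_recursion X : unipotent X ->
  karcher_equation w A (D *m X) <-> karcher_recursion w A X.
Proof.
move=> uX; have UX := unipotent_UT uX.
have UD := karcher_diag_UT.
have DXV i : invmx (D *m X) *m A i = invmx X *m N i.
  have UDX := UT_unitmx (UT_mul UD UX).
  apply: (can_inj (mulKmx UDX)); rewrite mulKVmx// /normalized.
  by rewrite -mulmxA mulKVmx ?UT_unitmx// mulKVmx ?UT_unitmx.
rewrite /karcher_equation; under eq_bigr do rewrite DXV.
split=> [[_ E]|[_ E]].
  split=> // p q pq; have := karcher_entry uX pq; rewrite E mxE => /esym/eqP.
  rewrite mulf_eq0 gt_eqF ?karcher_coef_gt0//= subr_eq0 => /eqP <-.
  by [].
split; first exact: UT_mul.
apply/matrixP => p q; rewrite [RHS]mxE.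
have BU i : UT (invmx X *m N i).
  by apply: UT_mul; [case: (UT_invmx UX)|exact: normalized_UT].
have [pq|qp|/val_inj <-] := ltngtP p q.
- by rewrite karcher_entry// /karcher_rhs -E// subrr mulr0.
- rewrite summxE big1// => i _.
  have [Lt _] := upper_triangular_logm (BU i).
  by rewrite mxE (upper_triangularP _ Lt)// mulr0.
(* On the diagonal, the weighted sum of ln a_pp - ln d_pp over the matrices A_i is 0 by the choice
   of D. *)
rewrite summxE.
have [UV Vd] := UT_invmx UX; have [UDV DVd] := UT_invmx UD.
under eq_bigr => i _.
  rewrite mxE (upper_triangular_logm (BU i)).2.
  rewrite upper_triangular_mul_diag ?Vd ?uX.2 ?invr1 ?mul1r; last 2 first.
  - by case: UV.
  - by case: (normalized_UT i).
  rewrite upper_triangular_mul_diag; last 2 first.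
  - by case: UDV.
  - by case: (A_UT i).
  rewrite DVd karcher_diagE eqxx mulr1n lnM; last 2 first.
  - by rewrite posrE invr_gt0 expR_gt0.
  - by rewrite posrE; case: (A_UT i).
  rewrite lnV ?posrE ?expR_gt0// expRK mulrDr.
  over.
by rewrite big_split /= -mulr_suml w_sum mul1r addrC subrr.
Qed.

(** As the weights sum to 1, the diagonal of the equation says that ln X_pp is the weighted mean of
    the logarithms, that is X_pp = D_pp. *)
Lemma karcher_equation_diag X : karcher_equation w A X ->
  unipotent (invmx D *m X).
Proof.
move=> [UX E]; have UD := karcher_diag_UT.
have [UV Vd] := UT_invmx UX; have [UDV DVd] := UT_invmx UD.
split=> [|p]; first by apply: upper_triangular_mul; [case: UDV|case: UX].
rewrite upper_triangular_mul_diag; last 2 first.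
- by case: UDV.
- by case: UX.
have Xp : 0 < X p p by case: UX.
rewrite DVd karcher_diagE eqxx mulr1n.
suff -> : log_mean p = ln (X p p) by rewrite lnK// mulVf// gt_eqF.
have /(congr1 (fun M : 'M[R]_n => M p p)) := E; rewrite mxE summxE.
have BU i : UT (invmx X *m A i) by exact: UT_mul.
under eq_bigr => i _.
  rewrite mxE (upper_triangular_logm (BU i)).2.
  rewrite upper_triangular_mul_diag; last 2 first.
  - by case: UV.
  - by case: (A_UT i).
  rewrite Vd lnM; last 2 first.
  - by rewrite posrE invr_gt0.
  - by rewrite posrE; case: (A_UT i).
  rewrite lnV// mulrDr.
  over.
rewrite big_split /= -mulr_suml w_sum mul1r addrC => /eqP.
by rewrite subr_eq0 => /eqP.
Qed.

End KarcherRecursion.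

Theorem theorem5p2 (R : realType) (m n : nat)
    (w : 'I_m -> R) (A : 'I_m -> 'M[R]_n)
    (w01 : forall i, 0 < w i < 1)
    (w_sum : \sum_(i < m) w i = 1)
    (A_UT : forall i, UT (A i)) :
  (forall p q : 'I_n, (p < q)%N -> karcher_coef w A p q != 0) /\
  exists2 X' : 'M[R]_n,
    unique (karcher_recursion w A) X' &
    is_karcher_mean w A (karcher_diag w A *m X').
Proof.
split=> [p q _|]; first by rewrite gt_eqF// karcher_coef_gt0.
have [X' [X'rec X'uniq]] := karcher_recursion_unique w A.
exists X' => //; split.
  by have [_] := karcher_equation_recursion w01 w_sum A_UT X'rec.1; exact.
(* Uniqueness: D^-1 X is unipotent and solves the recursion for any solution X, hence equals X'. *)
move=> X XE; have uX := karcher_equation_diag w_sum A_UT XE.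
have XD : karcher_diag w A *m (invmx (karcher_diag w A) *m X) = X.
  by rewrite mulKVmx// UT_unitmx//; exact: karcher_diag_UT.
rewrite -XD (X'uniq (invmx (karcher_diag w A) *m X))//.
have [+ _] := karcher_equation_recursion w01 w_sum A_UT uX.
by rewrite XD; exact.
Qed.
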